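(* Let $(\mathfrak g,\lhd,\mathfrak a)$ be a right Lie module over a field of characteristic zero and let $\mathbf T\colon\mathcal U(\mathfrak g)\to\mathcal U(\mathfrak a)$ be a Hopf $\mathcal O$-operator on $(\mathcal U(\mathfrak g),\lhd,\mathcal U(\mathfrak a))$. For $n\ge1$ set $\Gamma_n:=\mathbf T\circ\mathrm{sol}_n\colon\mathcal U(\mathfrak g)\to\mathcal U(\mathfrak a)$. Then for every $n\ge1$ and every $f\in\mathcal U(\mathfrak g)$, $$(n+1)\,\Gamma_{n+1}(f)=(\Gamma_n*\Gamma_1)(f)-\Gamma_n\big(f_{(1)}\lhd\Gamma_1(f_{(2)})\big)=\frac1{n!}\,\Gamma_1^{\#(n+1)}(f).$$ Hence $$\mathbf T=\exp_\#(\mathbf T\circ\mathrm{sol}_1).$$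
   Context: A right Lie module $(\mathfrak g,\lhd,\mathfrak a)$: Lie algebras $\mathfrak g,\mathfrak a$ and a bilinear map $\lhd\colon\mathfrak g\times\mathfrak a\to\mathfrak g$ with $[x,y]\lhd a=[x\lhd a,y]+[x,y\lhd a]$ and $x\lhd[a,b]=(x\lhd a)\lhd b-(x\lhd b)\lhd a$. The action extends uniquely to a right action $\lhd$ of the algebra $\mathcal U(\mathfrak a)$ on $\mathcal U(\mathfrak g)$ such that each $a\in\mathfrak a$ acts by the derivation extending $x\mapsto x\lhd a$; then $(XY)\lhd A=(X\lhd A_{(1)})(Y\lhd A_{(2)})$ and $\lhd$ is a coalgebra map. Enveloping algebras carry their standard cocommutative Hopf structure; $\varepsilon,\eta,\mathcal S$ are counit, unit, antipode; Sweedler notation is used. A Hopf $\mathcal O$-operator is a coalgebra map $\mathbf T\colon\mathcal U(\mathfrak g)\to\mathcal U(\mathfrak a)$ (preserving counits) with $\mathbf T(e)\mathbf T(f)=\mathbf T\big((e\lhd\mathbf T(f_{(1)}))f_{(2)}\big)$. For linear maps $A,B\colon\mathcal U(\mathfrak g)\to\mathcal U(\mathfrak a)$: $(A*B)(f)=A(f_{(1)})B(f_{(2)})$ and $(A\#B)(f)=A\big(f_{(1)}\lhd\mathcal S_{\mathcal U(\mathfrak a)}(B(f_{(2)})_{(1)})\big)\,B(f_{(2)})_{(2)}$ (associative, unit $\eta_{\mathcal U(\mathfrak a)}\circ\varepsilon_{\mathcal U(\mathfrak g)}$). $A^{\#n}$ is the $n$-th power for $\#$, and $\exp_\#(\alpha)=\eta_{\mathcal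 U(\mathfrak a)}\circ\varepsilon_{\mathcal U(\mathfrak g)}+\sum_{n\ge1}\frac1{n!}\alpha^{\#n}$ (a locally finite sum here). Solomon elements: on $\mathrm{End}(\mathcal U(\mathfrak g))$ with the convolution product $(\phi\cdot\psi)(f)=\phi(f_{(1)})\psi(f_{(2)})$, $\mathrm{sol}_1=\log(\mathrm{id})=\sum_{n\ge1}\frac{(-1)^{n-1}}n(\mathrm{id}-\eta\varepsilon)^{\cdot n}$ and $\mathrm{sol}_n=\frac1{n!}\mathrm{sol}_1^{\cdot n}$. *)

(* Defs.v *)
From HB Require Import structures.
From mathcomp Require Import all_boot all_order all_algebra.
From mathcomp Require Import boolp classical_sets functions cardinality fsbigop.
Set Implicit Arguments.
Unset Strict Implicit.
Unset Printing Implicit Defensive.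
Import GRing.Theory.
Local Open Scope ring_scope.
Local Open Scope quotient_scope.

HB.mixin Record isLieAlgebra (K : fieldType) V of GRing.Lmodule K V := {
  lie : V -> V -> V;
  lie_linearl : forall z (c : K) x y, lie (c *: x + y) z = c *: lie x z + lie y z;
  lie_linearr : forall z (c : K) x y, lie z (c *: x + y) = c *: lie z x + lie z y;
  liexx : forall x, lie x x = 0;
  lie_jacobi : forall x y z,
    lie x (lie y z) + lie y (lie z x) + lie z (lie x y) = 0
}.

#[short(type="lieAlgType")]
HB.structure Definition LieAlgebra (K : fieldType) :=
  { V of GRing.Lmodule K V & isLieAlgebra K V }.

Record rightLieModule (K : fieldType) (g a : lieAlgType K) := RightLieModule {
  lact :> g -> a -> g;
  lact_linearl : forall u (c : K) x y,
    lact (c *: x + y) u = c *: lact x u + lact y u;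
  lact_linearr : forall x (c : K) u v,
    lact x (c *: u + v) = c *: lact x u + lact x v;
  lact_der : forall x y u, lact (lie x y) u = lie (lact x u) y + lie x (lact y u);
  lact_lie : forall x u v,
    lact x (lie u v) = lact (lact x u) v - lact (lact x v) u
}.

(* Tensor product of K-modules: formal expressions in pure tensors modulo the
   congruence generated by the module axioms and bilinearity. *)
Section Tensor.
Variables (K : fieldType) (V W : lmodType K).

Inductive tterm :=
  | TPure of V & W
  | TAdd of tterm & tterm
  | TScale of K & tterm.

Inductive trel : tterm -> tterm -> Prop :=
  | trel_refl t : trel t t
  | trel_sym s t : trel s t -> trel t s
  | trel_trans s t u : trel s t -> trel t u -> trel s u
  | trel_add s s' t t' : trel s s' -> trel t t' -> trel (TAdd s t) (TAdd s' t')
  | trel_scale c s s' : trel s s' -> trel (TScale c s) (TScale c s')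
  | trel_addA s t u : trel (TAdd s (TAdd t u)) (TAdd (TAdd s t) u)
  | trel_addC s t : trel (TAdd s t) (TAdd t s)
  | trel_add0 t : trel (TAdd (TPure 0 0) t) t
  | trel_addN t : trel (TAdd (TScale (-1) t) t) (TPure 0 0)
  | trel_scaleA c d t : trel (TScale c (TScale d t)) (TScale (c * d) t)
  | trel_scale1 t : trel (TScale 1 t) t
  | trel_scaleDr c s t : trel (TScale c (TAdd s t)) (TAdd (TScale c s) (TScale c t))
  | trel_scaleDl c d t : trel (TScale (c + d) t) (TAdd (TScale c t) (TScale d t))
  | trel_linl c v v' w :
      trel (TPure (c *: v + v') w) (TAdd (TScale c (TPure v w)) (TPure v' w))
  | trel_linr c v w w' :
      trel (TPure v (c *: w + w')) (TAdd (TScale c (TPure v w)) (TPure v w')).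

HB.instance Definition _ := gen_eqMixin tterm.
HB.instance Definition _ := gen_choiceMixin tterm.

Definition trelb : rel tterm := fun s t => `[< trel s t >].
Lemma trelb_refl : reflexive trelb.
Proof. by move=> t; apply/asboolP; exact: trel_refl. Qed.
Lemma trelb_sym : symmetric trelb.
Proof. by move=> s t; apply/asboolP/asboolP; exact: trel_sym. Qed.
Lemma trelb_trans : transitive trelb.
Proof.
by move=> t s u /asboolP h1 /asboolP h2; apply/asboolP; exact: trel_trans h1 h2.
Qed.
Canonical trel_equiv := EquivRel trelb trelb_refl trelb_sym trelb_trans.

Definition tensor : Type := {eq_quot trel_equiv}.
HB.instance Definition _ : EqQuotient _ trel_equiv tensor := EqQuotient.on tensor.
HB.instance Definition _ := Choice.on tensor.

Definition tpi (t : tterm) : tensor := \pi_tensor t.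
Definition trepr (x : tensor) : tterm := repr x.

Lemma tpiE s t : tpi s = tpi t <-> trel s t.
Proof.
split=> [h|h]; first by apply/asboolP; apply/(@eqmodP _ trel_equiv).
by apply/(@eqmodP _ trel_equiv)/asboolP.
Qed.

Lemma treprK x : tpi (trepr x) = x. Proof. exact: reprK. Qed.

Lemma trepr_pi t : trel (trepr (tpi t)) t.
Proof. by apply/tpiE; rewrite treprK. Qed.

Definition tens (v : V) (w : W) : tensor := tpi (TPure v w).
Definition tens_add (x y : tensor) := tpi (TAdd (trepr x) (trepr y)).
Definition tens_scale (c : K) (x : tensor) := tpi (TScale c (trepr x)).

Lemma tpiD s t : tens_add (tpi s) (tpi t) = tpi (TAdd s t).
Proof. by apply/tpiE; apply: trel_add; exact: trepr_pi. Qed.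
Lemma tpiZ c t : tens_scale c (tpi t) = tpi (TScale c t).
Proof. by apply/tpiE; apply: trel_scale; exact: trepr_pi. Qed.
Lemma tpiW (P : tensor -> Prop) : (forall t, P (tpi t)) -> forall x, P x.
Proof. by move=> h x; rewrite -(treprK x). Qed.

Fact tens_addA : associative tens_add.
Proof.
move=> x y z; elim/tpiW: x => x; elim/tpiW: y => y; elim/tpiW: z => z.
by rewrite !tpiD; apply/tpiE/trel_addA.
Qed.
Fact tens_addC : commutative tens_add.
Proof.
by elim/tpiW=> x; elim/tpiW=> y; rewrite !tpiD; apply/tpiE/trel_addC.
Qed.
Fact tens_add0 : left_id (tens 0 0) tens_add.
Proof. by elim/tpiW=> x; rewrite tpiD; apply/tpiE/trel_add0. Qed.
Fact tens_addN : left_inverse (tens 0 0) (tens_scale (-1)) tens_add.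
Proof. by elim/tpiW=> x; rewrite tpiZ tpiD; apply/tpiE/trel_addN. Qed.

HB.instance Definition _ :=
  GRing.isZmodule.Build tensor tens_addA tens_addC tens_add0 tens_addN.

Fact tens_scaleA c d x : tens_scale c (tens_scale d x) = tens_scale (c * d) x.
Proof. by elim/tpiW: x => x; rewrite !tpiZ; apply/tpiE/trel_scaleA. Qed.
Fact tens_scale1 : left_id 1 tens_scale.
Proof. by elim/tpiW=> x; rewrite !tpiZ; apply/tpiE/trel_scale1. Qed.
Fact tens_scaleDr : right_distributive tens_scale +%R.
Proof.
move=> c; elim/tpiW=> x; elim/tpiW=> y; rewrite /GRing.add /= /tens_add.
by rewrite -/(tens_add _ _) -/(tens_add _ _) !(tpiD, tpiZ); apply/tpiE/trel_scaleDr.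
Qed.
Fact tens_scaleDl x : {morph tens_scale^~ x : c d / c + d}.
Proof.
elim/tpiW: x => x c d; rewrite [RHS]/GRing.add /=.
by rewrite !(tpiD, tpiZ); apply/tpiE/trel_scaleDl.
Qed.

HB.instance Definition _ := GRing.Zmodule_isLmodule.Build K tensor
  tens_scaleA tens_scale1 tens_scaleDr tens_scaleDl.

Lemma tpi_add s t : tpi (TAdd s t) = tpi s + tpi t. Proof. by rewrite -tpiD. Qed.
Lemma tpi_scale c t : tpi (TScale c t) = c *: tpi t. Proof. by rewrite -tpiZ. Qed.

Lemma tens_linl w c v v' : tens (c *: v + v') w = c *: tens v w + tens v' w.
Proof. by rewrite -tpi_scale -tpi_add; apply/tpiE/trel_linl. Qed.
Lemma tens_linr v c w w' : tens v (c *: w + w') = c *: tens v w + tens v w'.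
Proof. by rewrite -tpi_scale -tpi_add; apply/tpiE/trel_linr. Qed.

Lemma tens_ind (P : tensor -> Prop) :
  (forall v w, P (tens v w)) -> (forall x y, P x -> P y -> P (x + y)) ->
  (forall c x, P x -> P (c *: x)) -> forall x, P x.
Proof.
move=> hp ha hs; elim/tpiW; elim=> [v w|s hs' t ht|c s hs'].
- exact: hp.
- by rewrite tpi_add; exact: ha.
- by rewrite tpi_scale; exact: hs.
Qed.

Definition bilin (X : lmodType K) (b : V -> W -> X) :=
  (forall w c v v', b (c *: v + v') w = c *: b v w + b v' w) /\
  (forall v c w w', b v (c *: w + w') = c *: b v w + b v w').

Fixpoint teval (X : lmodType K) (b : V -> W -> X) (t : tterm) : X :=
  match t with
  | TPure v w => b v w
  | TAdd s t => teval b s + teval b t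
  | TScale c s => c *: teval b s
  end.

(* The linear map on V (x) W induced by the bilinear map b; it is a total
   function of b for convenience, and meaningless when b is not bilinear. *)
Definition tlift (X : lmodType K) (b : V -> W -> X) (x : tensor) : X :=
  teval b (trepr x).

Section Lift.
Variables (X : lmodType K) (b : V -> W -> X).
Hypothesis bb : bilin b.

Lemma bilin0l w : b 0 w = 0.
Proof.
have /= := bb.1 w 1 0 0; rewrite !scale1r addr0 => h.
by apply: (addrI (b 0 w)); rewrite -h addr0.
Qed.

Lemma bilin0r v : b v 0 = 0.
Proof.
have /= := bb.2 v 1 0 0; rewrite !scale1r addr0 => h.
by apply: (addrI (b v 0)); rewrite -h addr0.
Qed.

Lemma teval_compat s t : trel s t -> teval b s = teval b t.
Proof.
elim=> {s t} //=.
- by move=> s t u _ -> _ ->.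
- by move=> s s' t t' _ -> _ ->.
- by move=> c s s' _ ->.
- by move=> s t u; rewrite addrA.
- by move=> s t; rewrite addrC.
- by move=> t; rewrite bilin0l add0r.
- by move=> t; rewrite bilin0l scaleN1r addNr.
- by move=> c d t; rewrite scalerA.
- by move=> t; rewrite scale1r.
- by move=> c s t; rewrite scalerDr.
- by move=> c d t; rewrite scalerDl.
- by move=> c v v' w; rewrite bb.1.
- by move=> c v w w'; rewrite bb.2.
Qed.

Lemma tlift_pi t : tlift b (tpi t) = teval b t.
Proof. exact/teval_compat/trepr_pi. Qed.
Lemma tlift_tens v w : tlift b (tens v w) = b v w. Proof. exact: tlift_pi. Qed.
Lemma tliftD x y : tlift b (x + y) = tlift b x + tlift b y.
Proof.
by elim/tpiW: x => x; elim/tpiW: y => y; rewrite -tpi_add !tlift_pi.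
Qed.
Lemma tliftZ c x : tlift b (c *: x) = c *: tlift b x.
Proof. by elim/tpiW: x => x; rewrite -tpi_scale !tlift_pi. Qed.
Lemma tlift_lin c x y : tlift b (c *: x + y) = c *: tlift b x + tlift b y.
Proof. by rewrite tliftD tliftZ. Qed.
End Lift.

Lemma tens_bilin : bilin tens.
Proof. by split=> *; rewrite (tens_linl, tens_linr). Qed.

Lemma eq_tlift (X : lmodType K) (b b' : V -> W -> X) x :
  (forall v w, b v w = b' v w) -> tlift b x = tlift b' x.
Proof.
by move=> h; rewrite /tlift; elim: (trepr x) => //= [s -> t ->|c s ->].
Qed.
End Tensor.

Notation "v '\ox' w" := (tens v w) (at level 40, left associativity) : ring_scope.

Section TensorAlgebra.
Variables (K : fieldType) (A B : algType K).
Local Notation AB := (tensor A B).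

Definition tmul (x y : AB) : AB :=
  tlift (fun a b => tlift (fun a' b' => (a * a') \ox (b * b')) y) x.

Lemma tmul_bil_in a b : bilin (fun a' b' => ((a * a') \ox (b * b')) : AB).
Proof.
by split=> [w c v v'|v c w w']; rewrite mulrDr -scalerAr (tens_linl, tens_linr).
Qed.

Lemma tmul_bil_out y :
  bilin (fun a b => tlift (fun a' b' => (a * a') \ox (b * b')) y : AB).
Proof.
have h := tmul_bil_in; split=> [w c v v'|v c w w'];
  elim/tens_ind: y => [a b|y z hy hz|d y hy];
  rewrite ?(tlift_tens (h _ _)) ?(tliftD (h _ _)) ?(tliftZ (h _ _)).
- by rewrite mulrDl -scalerAl tens_linl.
- by rewrite hy hz scalerDr addrACA.
- by rewrite hy scalerDr !scalerA mulrC.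
- by rewrite mulrDl -scalerAl tens_linr.
- by rewrite hy hz scalerDr addrACA.
- by rewrite hy scalerDr !scalerA mulrC.
Qed.

Lemma tmul_tens a b a' b' : tmul (a \ox b) (a' \ox b') = (a * a') \ox (b * b').
Proof. by rewrite /tmul (tlift_tens (tmul_bil_out _)) (tlift_tens (tmul_bil_in _ _)). Qed.
Fact tmulDl : left_distributive tmul +%R.
Proof. by move=> x y z; rewrite /tmul (tliftD (tmul_bil_out _)). Qed.
Lemma tmulZl c x y : tmul (c *: x) y = c *: tmul x y.
Proof. by rewrite /tmul (tliftZ (tmul_bil_out _)). Qed.
Fact tmulDr : right_distributive tmul +%R.
Proof.
move=> x y z; elim/tens_ind: x => [a b|x x' hx hx'|c x hx].
- by rewrite /tmul !(tlift_tens (tmul_bil_out _)) (tliftD (tmul_bil_in _ _)).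
- by rewrite !tmulDl hx hx' addrACA.
- by rewrite !tmulZl hx scalerDr.
Qed.
Lemma tmulZr c x y : tmul x (c *: y) = c *: tmul x y.
Proof.
elim/tens_ind: x => [a b|x x' hx hx'|d x hx].
- by rewrite /tmul !(tlift_tens (tmul_bil_out _)) (tliftZ (tmul_bil_in _ _)).
- by rewrite !tmulDl hx hx' scalerDr.
- by rewrite !tmulZl hx !scalerA mulrC.
Qed.
Fact tmulA : associative tmul.
Proof.
move=> x y z; elim/tens_ind: x => [a b|x x' hx hx'|d x hx];
  [|by rewrite !tmulDl hx hx'|by rewrite !tmulZl hx].
elim/tens_ind: y => [a' b'|y y' hy hy'|d y hy];
  [|by rewrite !(tmulDl, tmulDr) hy hy'|by rewrite !(tmulZl, tmulZr) hy].
elim/tens_ind: z => [a'' b''|z z' hz hz'|d z hz];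
  [|by rewrite !tmulDr hz hz'|by rewrite !tmulZr hz].
by rewrite !tmul_tens !mulrA.
Qed.
Fact tmul1x : left_id (1 \ox 1) tmul.
Proof.
by elim/tens_ind=> [a b|x y hx hy|c x hx];
  rewrite ?tmul_tens ?mul1r // ?tmulDr ?hx ?hy // tmulZr hx.
Qed.
Fact tmulx1 : right_id (1 \ox 1) tmul.
Proof.
by elim/tens_ind=> [a b|x y hx hy|c x hx];
  rewrite ?tmul_tens ?mulr1 // ?tmulDl ?hx ?hy // tmulZl hx.
Qed.

HB.instance Definition _ := GRing.Zmodule_isPzRing.Build (tensor A B)
  tmulA tmul1x tmulx1 tmulDl tmulDr.

Lemma tensM a b a' b' : (a \ox b) * (a' \ox b') = (a * a') \ox (b * b') :> AB.
Proof. exact: tmul_tens. Qed.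
Lemma tens_scaleAl c (x y : AB) : c *: (x * y) = (c *: x) * y.
Proof. by rewrite [in RHS]/GRing.mul /= tmulZl. Qed.
Lemma tens_scaleAr c (x y : AB) : c *: (x * y) = x * (c *: y).
Proof. by rewrite [in RHS]/GRing.mul /= tmulZr. Qed.
End TensorAlgebra.

(* The enveloping algebra: the unital associative K-algebra presented by the
   elements of g as generators, subject to linearity of x |-> UGen x and to
   UGen [x, y] = UGen x UGen y - UGen y UGen x. *)
Section Enveloping.
Variables (K : fieldType) (g : lieAlgType K).

Inductive uterm :=
  | UConst of K
  | UGen of g
  | UAdd of uterm & uterm
  | UMul of uterm & uterm.

Inductive urel : uterm -> uterm -> Prop :=
  | urel_refl t : urel t t
  | urel_sym s t : urel s t -> urel t s
  | urel_trans s t u : urel s t -> urel t u -> urel s u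
  | urel_add s s' t t' : urel s s' -> urel t t' -> urel (UAdd s t) (UAdd s' t')
  | urel_mul s s' t t' : urel s s' -> urel t t' -> urel (UMul s t) (UMul s' t')
  | urel_addA s t u : urel (UAdd s (UAdd t u)) (UAdd (UAdd s t) u)
  | urel_addC s t : urel (UAdd s t) (UAdd t s)
  | urel_add0 t : urel (UAdd (UConst 0) t) t
  | urel_addN t : urel (UAdd (UMul (UConst (-1)) t) t) (UConst 0)
  | urel_mulA s t u : urel (UMul s (UMul t u)) (UMul (UMul s t) u)
  | urel_mul1 t : urel (UMul (UConst 1) t) t
  | urel_mulDl s t u : urel (UMul (UAdd s t) u) (UAdd (UMul s u) (UMul t u))
  | urel_mulDr s t u : urel (UMul s (UAdd t u)) (UAdd (UMul s t) (UMul s u))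
  | urel_constD c d : urel (UConst (c + d)) (UAdd (UConst c) (UConst d))
  | urel_constM c d : urel (UConst (c * d)) (UMul (UConst c) (UConst d))
  | urel_constC c t : urel (UMul (UConst c) t) (UMul t (UConst c))
  | urel_genD x y : urel (UGen (x + y)) (UAdd (UGen x) (UGen y))
  | urel_genZ c x : urel (UGen (c *: x)) (UMul (UConst c) (UGen x))
  | urel_lie x y : urel (UGen (lie x y))
      (UAdd (UMul (UGen x) (UGen y))
            (UMul (UConst (-1)) (UMul (UGen y) (UGen x)))).

HB.instance Definition _ := gen_eqMixin uterm.
HB.instance Definition _ := gen_choiceMixin uterm.

Definition urelb : rel uterm := fun s t => `[< urel s t >].
Lemma urelb_refl : reflexive urelb.
Proof. by move=> t; apply/asboolP; exact: urel_refl. Qed.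
Lemma urelb_sym : symmetric urelb.
Proof. by move=> s t; apply/asboolP/asboolP; exact: urel_sym. Qed.
Lemma urelb_trans : transitive urelb.
Proof.
by move=> t s u /asboolP h1 /asboolP h2; apply/asboolP; exact: urel_trans h1 h2.
Qed.
Canonical urel_equiv := EquivRel urelb urelb_refl urelb_sym urelb_trans.

Definition Uenv : Type := {eq_quot urel_equiv}.
HB.instance Definition _ : EqQuotient _ urel_equiv Uenv := EqQuotient.on Uenv.
HB.instance Definition _ := Choice.on Uenv.

Definition upi (t : uterm) : Uenv := \pi_Uenv t.
Definition urepr (x : Uenv) : uterm := repr x.

Lemma upiE s t : upi s = upi t <-> urel s t.
Proof.
split=> [h|h]; first by apply/asboolP; apply/(@eqmodP _ urel_equiv).
by apply/(@eqmodP _ urel_equiv)/asboolP.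
Qed.
Lemma ureprK x : upi (urepr x) = x. Proof. exact: reprK. Qed.
Lemma urepr_pi t : urel (urepr (upi t)) t.
Proof. by apply/upiE; rewrite ureprK. Qed.
Lemma upiW (P : Uenv -> Prop) : (forall t, P (upi t)) -> forall x, P x.
Proof. by move=> h x; rewrite -(ureprK x). Qed.

(* Interpretation of expressions in an additive group X carrying a product ml
   for which the laws of an enveloping algebra hold on a subset P. *)
Fixpoint ueval (X : zmodType) (c : K -> X) (gn : g -> X) (ml : X -> X -> X)
    (t : uterm) : X :=
  match t with
  | UConst k => c k
  | UGen x => gn x
  | UAdd s t => ueval c gn ml s + ueval c gn ml t
  | UMul s t => ml (ueval c gn ml s) (ueval c gn ml t)
  end.

Record umodel (X : zmodType) (P : X -> Prop) (c : K -> X) (gn : g -> X)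
    (ml : X -> X -> X) : Prop := {
  um_Pc : forall k, P (c k);
  um_Pg : forall x, P (gn x);
  um_PD : forall u v, P u -> P v -> P (u + v);
  um_PM : forall u v, P u -> P v -> P (ml u v);
  um_mulA : forall u v w, P u -> P v -> P w -> ml u (ml v w) = ml (ml u v) w;
  um_mul1 : forall u, P u -> ml (c 1) u = u;
  um_mulDl : forall u v w, P u -> P v -> P w -> ml (u + v) w = ml u w + ml v w;
  um_mulDr : forall u v w, P u -> P v -> P w -> ml u (v + w) = ml u v + ml u w;
  um_cD : forall k l, c (k + l) = c k + c l;
  um_cM : forall k l, c (k * l) = ml (c k) (c l);
  um_cC : forall k u, P u -> ml (c k) u = ml u (c k);
  um_gD : forall x y, gn (x + y) = gn x + gn y;
  um_gZ : forall k x, gn (k *: x) = ml (c k) (gn x);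
  um_lie : forall x y, gn (lie x y) = ml (gn x) (gn y) - ml (gn y) (gn x)
}.

Section Eval.
Variables (X : zmodType) (P : X -> Prop) (c : K -> X) (gn : g -> X).
Variable (ml : X -> X -> X).
Hypothesis um : umodel P c gn ml.

Lemma ueval_P t : P (ueval c gn ml t).
Proof.
elim: t => [k|x|s hs t ht|s hs t ht] /=.
- exact: um_Pc um _.
- exact: um_Pg um _.
- exact: um_PD um _ _ hs ht.
- exact: um_PM um _ _ hs ht.
Qed.

Lemma um_c0 : c 0 = 0.
Proof. by apply: (addrI (c 0)); rewrite -(um_cD um) !addr0. Qed.

Lemma um_N u : P u -> ml (c (-1)) u = - u.
Proof.
move=> Pu; apply/eqP; rewrite -addr_eq0 -{2}(um_mul1 um Pu).
rewrite -(um_mulDl um) -?(um_cD um) ?addNr; try exact: um_Pc um _; last by [].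
apply/eqP/(addrI (ml (c 0) u)); rewrite addr0.
rewrite -(um_mulDl um) -?(um_cD um) ?addr0 //; exact: um_Pc um _.
Qed.

Lemma ueval_compat s t : urel s t -> ueval c gn ml s = ueval c gn ml t.
Proof.
have hP := ueval_P; elim=> {s t} //=.
- by move=> s t u _ -> _ ->.
- by move=> s s' t t' _ -> _ ->.
- by move=> s s' t t' _ -> _ ->.
- by move=> s t u; rewrite addrA.
- by move=> s t; rewrite addrC.
- by move=> t; rewrite um_c0 add0r.
- by move=> t; rewrite um_N // um_c0 addNr.
- by move=> s t u; rewrite (um_mulA um).
- by move=> t; rewrite (um_mul1 um).
- by move=> s t u; rewrite (um_mulDl um).
- by move=> s t u; rewrite (um_mulDr um).
- by move=> k l; rewrite (um_cD um).
- by move=> k l; rewrite (um_cM um).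
- by move=> k t; rewrite (um_cC um).
- by move=> x y; rewrite (um_gD um).
- by move=> k x; rewrite (um_gZ um).
- by move=> x y; rewrite (um_lie um) um_N //; apply: um_PM um _ _ _ _; apply: um_Pg um _.
Qed.

Lemma ueval_repr t : ueval c gn ml (urepr (upi t)) = ueval c gn ml t.
Proof. exact/ueval_compat/urepr_pi. Qed.
End Eval.

Definition uadd (x y : Uenv) := upi (UAdd (urepr x) (urepr y)).
Definition umul (x y : Uenv) := upi (UMul (urepr x) (urepr y)).
Definition uconst (c : K) : Uenv := upi (UConst c).
Definition uopp (x : Uenv) := umul (uconst (-1)) x.
Definition uscale (c : K) (x : Uenv) := umul (uconst c) x.
Definition ugen (x : g) : Uenv := upi (UGen x).

Lemma upiD s t : uadd (upi s) (upi t) = upi (UAdd s t).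
Proof. by apply/upiE; apply: urel_add; exact: urepr_pi. Qed.
Lemma upiM s t : umul (upi s) (upi t) = upi (UMul s t).
Proof. by apply/upiE; apply: urel_mul; exact: urepr_pi. Qed.
Let upiDM := (upiD, upiM).

Fact uaddA : associative uadd.
Proof.
elim/upiW=> x; elim/upiW=> y; elim/upiW=> z.
by rewrite !upiD; apply/upiE/urel_addA.
Qed.
Fact uaddC : commutative uadd.
Proof. by elim/upiW=> x; elim/upiW=> y; rewrite !upiD; apply/upiE/urel_addC. Qed.
Fact uadd0 : left_id (uconst 0) uadd.
Proof. by elim/upiW=> x; rewrite /uconst upiD; apply/upiE/urel_add0. Qed.
Fact uaddN : left_inverse (uconst 0) uopp uadd.
Proof. by elim/upiW=> x; rewrite /uopp /uconst upiM upiD; apply/upiE/urel_addN. Qed.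
HB.instance Definition _ := GRing.isZmodule.Build Uenv uaddA uaddC uadd0 uaddN.

Fact umulA : associative umul.
Proof.
elim/upiW=> x; elim/upiW=> y; elim/upiW=> z.
by rewrite !upiM; apply/upiE/urel_mulA.
Qed.
Fact umul1x : left_id (uconst 1) umul.
Proof. by elim/upiW=> x; rewrite /uconst upiM; apply/upiE/urel_mul1. Qed.
Fact umulx1 : right_id (uconst 1) umul.
Proof.
elim/upiW=> x; rewrite /uconst upiM; apply/upiE.
exact: urel_trans (urel_sym (urel_constC _ _)) (urel_mul1 _).
Qed.
Fact umulDl : left_distributive umul uadd.
Proof.
elim/upiW=> x; elim/upiW=> y; elim/upiW=> z.
by rewrite !upiDM; apply/upiE/urel_mulDl.
Qed.
Fact umulDr : right_distributive umul uadd.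
Proof.
elim/upiW=> x; elim/upiW=> y; elim/upiW=> z.
by rewrite !upiDM; apply/upiE/urel_mulDr.
Qed.

Lemma counit_model : umodel (fun=> True) (id : K -> K) (fun _ : g => 0) *%R.
Proof.
split=> //= *; rewrite ?mulr0 ?addr0 ?subr0 ?mulrA ?mul1r ?mulrDl ?mulrDr //.
by rewrite mulrC.
Qed.

Definition counit (x : Uenv) : K := ueval id (fun=> 0) *%R (urepr x).
Let counit_pi t : counit (upi t) = ueval id (fun=> 0) *%R t.
Proof. exact: ueval_repr counit_model _. Qed.

Fact uone_neq0 : uconst 1 != uconst 0.
Proof.
apply/eqP=> /(congr1 counit); rewrite !counit_pi /= => /eqP.
by rewrite oner_eq0.
Qed.

HB.instance Definition _ := GRing.Zmodule_isNzRing.Build Uenv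
  umulA umul1x umulx1 umulDl umulDr uone_neq0.

Fact uscaleA c d x : uscale c (uscale d x) = uscale (c * d) x.
Proof.
by rewrite /uscale umulA /uconst upiM; congr umul; apply/upiE/urel_sym/urel_constM.
Qed.
Fact uscaleDr : right_distributive uscale +%R.
Proof. by move=> c x y; exact: umulDr. Qed.
Fact uscaleDl x : {morph uscale^~ x : c d / c + d}.
Proof.
move=> c d; rewrite -[RHS]umulDl /uscale; congr umul.
by rewrite /uconst upiD; apply/upiE/urel_constD.
Qed.
HB.instance Definition _ := GRing.Zmodule_isLmodule.Build K Uenv
  uscaleA umul1x uscaleDr uscaleDl.
Fact uscaleAl (c : K) (x y : Uenv) : c *: (x * y) = (c *: x) * y.
Proof. exact: umulA. Qed.
HB.instance Definition _ := GRing.Lmodule_isLalgebra.Build K Uenv uscaleAl.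
Fact uscaleAr (c : K) (x y : Uenv) : c *: (x * y) = x * (c *: y).
Proof.
rewrite [LHS]umulA [RHS]umulA; congr umul.
by elim/upiW: x => x; rewrite /uconst !upiM; apply/upiE/urel_constC.
Qed.
HB.instance Definition _ := GRing.Lalgebra_isAlgebra.Build K Uenv uscaleAr.

Lemma upi_add s t : upi (UAdd s t) = upi s + upi t. Proof. by rewrite -upiD. Qed.
Lemma upi_mul s t : upi (UMul s t) = upi s * upi t. Proof. by rewrite -upiM. Qed.
Lemma upi_const c : upi (UConst c) = c%:A.
Proof. by rewrite -[LHS]umulx1. Qed.
Lemma upi_gen x : upi (UGen x) = ugen x. Proof. by []. Qed.

Fact ugen_is_linear : linear ugen.
Proof.
move=> c x y; transitivity (upi (UAdd (UGen (c *: x)) (UGen y))).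
  by apply/upiE/urel_genD.
have -> : c *: ugen x = upi (UMul (UConst c) (UGen x)) by rewrite -upiM.
by rewrite upi_add; congr (_ + _); apply/upiE/urel_genZ.
Qed.
HB.instance Definition _ := GRing.isLinear.Build K g Uenv *:%R ugen ugen_is_linear.

Lemma ugen_lie x y : ugen (lie x y) = ugen x * ugen y - ugen y * ugen x.
Proof.
transitivity (upi (UAdd (UMul (UGen x) (UGen y))
            (UMul (UConst (-1)) (UMul (UGen y) (UGen x))))).
  by apply/upiE/urel_lie.
by rewrite upi_add !upi_mul upi_const mulr_algl scaleN1r.
Qed.

Lemma Uenv_ind (P : Uenv -> Prop) :
  P 1 -> (forall x, P (ugen x)) -> (forall u v, P u -> P v -> P (u + v)) ->
  (forall c u, P u -> P (c *: u)) ->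
  (forall u v, P u -> P v -> P (u * v)) -> forall u, P u.
Proof.
move=> h1 hg hD hZ hM; elim/upiW; elim=> [k|x|s hs t ht|s hs t ht].
- by rewrite upi_const; exact: hZ.
- exact: hg.
- by rewrite upi_add; exact: hD.
- by rewrite upi_mul; exact: hM.
Qed.

Lemma Uenv_lrmorph_ext (A : algType K) (F G : {lrmorphism Uenv -> A}) :
  (forall x, F (ugen x) = G (ugen x)) -> F =1 G.
Proof.
move=> h; elim/Uenv_ind=> [|x|u v hu hv|c u hu|u v hu hv].
- by rewrite !rmorph1.
- exact: h.
- by rewrite !rmorphD /= hu hv.
- by rewrite !linearZ /= hu.
- by rewrite !rmorphM /= hu hv.
Qed.

Lemma Uenv_universal (A : algType K) (f : {linear g -> A}) :
  (forall x y, f (lie x y) = f x * f y - f y * f x) ->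
  exists2 F : {lrmorphism Uenv -> A}, (forall x, F (ugen x) = f x)
    & forall G : {lrmorphism Uenv -> A}, (forall x, G (ugen x) = f x) -> G =1 F.
Proof.
move=> hf.
pose ev := ueval (fun k : K => k%:A) f *%R.
have um : umodel (fun _ : A => True) (fun k : K => k%:A) f *%R.
  split=> //= *; rewrite ?mulrA ?scale1r ?mul1r ?mulrDl ?mulrDr ?scalerDl //.
  - by rewrite mulr_algl scalerA.
  - by rewrite mulr_algl mulr_algr.
  - by rewrite linearD.
  - by rewrite linearZ mulr_algl.
pose F (u : Uenv) : A := ev (urepr u).
have Fpi t : F (upi t) = ev t by exact: ueval_repr um _.
have FM : {morph F : u v / u * v}.
  by elim/upiW=> s; elim/upiW=> t; rewrite -upi_mul !Fpi.
have F1 : F 1 = 1 by rewrite -[LHS]/(F (upi (UConst 1))) Fpi /ev /= scale1r.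
have Flin : linear F.
  move=> c; elim/upiW=> s; elim/upiW=> t.
  by rewrite -mulr_algl -upi_const -upi_mul -upi_add !Fpi /ev /= mulr_algl.
pose mF := GRing.isMonoidMorphism.Build Uenv A F (conj F1 FM).
pose lF := GRing.isLinear.Build K Uenv A *:%R F Flin.
pose FF : {lrmorphism Uenv -> A} := HB.pack F mF lF.
exists FF => [x|G hG]; first exact: Fpi (UGen x).
by apply: Uenv_lrmorph_ext => x; rewrite hG; apply/esym/(Fpi (UGen x)).
Qed.

Fact counit_monoid : monoid_morphism counit.
Proof.
split; first by rewrite -[LHS]/(counit (upi (UConst 1))) counit_pi.
by elim/upiW=> s; elim/upiW=> t; rewrite -upi_mul !counit_pi.
Qed.
Fact counit_linear : scalar counit.
Proof.
move=> c; elim/upiW=> s; elim/upiW=> t.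
by rewrite -mulr_algl -upi_const -upi_mul -upi_add !counit_pi.
Qed.
HB.instance Definition _ := GRing.isLinear.Build K Uenv K *%R counit counit_linear.
HB.instance Definition _ := GRing.isMonoidMorphism.Build Uenv K counit counit_monoid.
Lemma counit_gen x : counit (ugen x) = 0.
Proof. exact: counit_pi (UGen x). Qed.

Definition prim (x : g) : tensor Uenv Uenv := ugen x \ox 1 + 1 \ox ugen x.

Lemma coprod_model : umodel (fun=> True) (fun k : K => k *: (1 : tensor Uenv Uenv))
  prim *%R.
Proof.
split=> //=.
- by move=> *; rewrite mulrA.
- by move=> *; rewrite scale1r mul1r.
- by move=> *; rewrite mulrDl.
- by move=> *; rewrite mulrDr.
- by move=> *; rewrite scalerDl.
- by move=> *; rewrite -tens_scaleAl mul1r scalerA.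
- by move=> *; rewrite -tens_scaleAl -tens_scaleAr mul1r mulr1.
- move=> x y; rewrite /prim -[x]scale1r !linearP /= (tens_linl _ 1) (tens_linr _ 1).
  by rewrite !scale1r addrACA.
- move=> k x; rewrite /prim -tens_scaleAl mul1r -[k *: x]addr0 !linearP /= linear0.
  rewrite (tens_linl _ k) (tens_linr _ k) (bilin0l (tens_bilin _ _)).
  by rewrite (bilin0r (tens_bilin _ _)) !addr0 scalerDr.
- move=> x y; rewrite /prim ugen_lie !mulrDl !mulrDr !tensM !mulr1 !mul1r.
  have hl u v w : (u - v : Uenv) \ox w = u \ox w - v \ox w :> tensor Uenv Uenv.
    by rewrite -scaleN1r addrC tens_linl scaleN1r addrC.
  have hr u v w : w \ox (u - v : Uenv) = w \ox u - w \ox v :> tensor Uenv Uenv.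
    by rewrite -scaleN1r addrC tens_linr scaleN1r addrC.
  rewrite hl hr; set A := _ \ox 1; set B := _ \ox 1.
  set C := 1 \ox _; set D := 1 \ox _; set E := _ \ox ugen y; set F := _ \ox ugen x.
  rewrite [F + C]addrC [A + E + _]addrACA [E + D]addrC [B + F + _]addrACA.
  by rewrite [F + E]addrC [in RHS]opprD [RHS]addrACA subrr addr0 opprD addrACA.
Qed.

Definition coprod (x : Uenv) : tensor Uenv Uenv :=
  ueval (fun k : K => k *: (1 : tensor Uenv Uenv)) prim *%R (urepr x).
Let coprod_pi t : coprod (upi t) =
  ueval (fun k : K => k *: (1 : tensor Uenv Uenv)) prim *%R t.
Proof. exact: ueval_repr coprod_model _. Qed.

Fact coprod_monoid : monoid_morphism coprod.
Proof.
split; first by rewrite -[LHS]/(coprod (upi (UConst 1))) coprod_pi /= scale1r.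
by elim/upiW=> s; elim/upiW=> t; rewrite -upi_mul !coprod_pi.
Qed.
Fact coprod_linear : linear coprod.
Proof.
move=> c; elim/upiW=> s; elim/upiW=> t.
rewrite -mulr_algl -upi_const -upi_mul -upi_add !coprod_pi /=.
by rewrite -tens_scaleAl mul1r.
Qed.
HB.instance Definition _ :=
  GRing.isLinear.Build K Uenv (tensor Uenv Uenv) *:%R coprod coprod_linear.
HB.instance Definition _ :=
  GRing.isMonoidMorphism.Build Uenv (tensor Uenv Uenv) coprod coprod_monoid.
Lemma coprod_gen x : coprod (ugen x) = ugen x \ox 1 + 1 \ox ugen x.
Proof. exact: coprod_pi (UGen x). Qed.

Lemma antipode_model : umodel (fun=> True) (fun k : K => k%:A : Uenv)
  (fun x => - ugen x) (fun u v => v * u).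
Proof.
split=> //=.
- by move=> *; rewrite mulrA.
- by move=> *; rewrite scale1r mulr1.
- by move=> *; rewrite mulrDr.
- by move=> *; rewrite mulrDl.
- by move=> *; rewrite scalerDl.
- by move=> *; rewrite mulr_algl scalerA mulrC.
- by move=> *; rewrite mulr_algl mulr_algr.
- by move=> *; rewrite linearD opprD.
- by move=> *; rewrite linearZ mulr_algr scalerN.
- by move=> *; rewrite ugen_lie !mulrNN opprB.
Qed.

Definition antipode (x : Uenv) : Uenv :=
  ueval (fun k : K => k%:A : Uenv) (fun x => - ugen x) (fun u v => v * u) (urepr x).
Let antipode_pi t : antipode (upi t) =
  ueval (fun k : K => k%:A : Uenv) (fun x => - ugen x) (fun u v => v * u) t.
Proof. exact: ueval_repr antipode_model _. Qed.

Fact antipode_linear : linear antipode.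
Proof.
move=> c; elim/upiW=> s; elim/upiW=> t.
rewrite -mulr_algl -upi_const -upi_mul -upi_add !antipode_pi /=.
by rewrite mulr_algr.
Qed.
HB.instance Definition _ := GRing.isLinear.Build K Uenv Uenv *:%R antipode antipode_linear.
Lemma antipode1 : antipode 1 = 1.
Proof. by rewrite -[LHS]/(antipode (upi (UConst 1))) antipode_pi /= scale1r. Qed.
Lemma antipodeM u v : antipode (u * v) = antipode v * antipode u.
Proof. by elim/upiW: u => s; elim/upiW: v => t; rewrite -upi_mul !antipode_pi. Qed.
Lemma antipode_gen x : antipode (ugen x) = - ugen x.
Proof. exact: antipode_pi (UGen x). Qed.

End Enveloping.

Definition sweedler (K : fieldType) (g : lieAlgType K) (X : lmodType K)
  (b : Uenv g -> Uenv g -> X) (f : Uenv g) : X := tlift b (coprod f).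

(* Sweedler notation: E(f_(1), f_(2)) with bound variables x for f_(1) and y for
   f_(2); E must be bilinear in (x, y). *)
Notation "'\sw_' ( x , y '<-' f ) E" := (sweedler (fun x y => E) f)
  (at level 41, x name, y name, f at level 60, E at level 41,
   format "'[' '\sw_' ( x ,  y  '<-'  f ) '/  '  E ']'") : ring_scope.

Section Action.
Variables (K : fieldType) (g a : lieAlgType K) (M : rightLieModule g a).
Local Notation Ug := (Uenv g).
Local Notation Ua := (Uenv a).

(* The derivation of Ug extending x |-> M x u, obtained as the second component
   of an algebra morphism into the square-zero extension Ug (+) Ug. *)
Definition sqz_mul (p q : Ug * Ug) : Ug * Ug :=
  (p.1 * q.1, p.2 * q.1 + p.1 * q.2).
Definition sqz_gen (u : a) (x : g) : Ug * Ug := (ugen x, ugen (M x u)).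

Lemma lactD x y u : M (x + y) u = M x u + M y u.
Proof. by have := lact_linearl M u 1 x y; rewrite !scale1r. Qed.
Lemma lact0 u : M 0 u = 0.
Proof. by apply: (addrI (M 0 u)); rewrite -lactD !addr0. Qed.
Lemma lactZ c x u : M (c *: x) u = c *: M x u.
Proof. by have := lact_linearl M u c x 0; rewrite lact0 !addr0. Qed.

Lemma sqz_model u : umodel (fun=> True) (fun k : K => (k%:A, 0) : Ug * Ug)
  (sqz_gen u) sqz_mul.
Proof.
rewrite /sqz_mul /sqz_gen; split=> //=.
- by move=> p q r _ _ _ /=; rewrite !mulrA !mulrDl !mulrDr !mulrA addrA.
- by move=> [p p'] _ /=; rewrite scale1r !mul1r mul0r add0r.
- by move=> p q r _ _ _ /=; rewrite !mulrDl -[RHS]/(_, _) /= [in RHS]addrACA.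
- by move=> p q r _ _ _ /=; rewrite !mulrDr -[RHS]/(_, _) /= [in RHS]addrACA.
- by move=> k l; rewrite scalerDl -[RHS]/(_, _) /= addr0.
- by move=> k l; rewrite mulr_algl scalerA mulr0 mul0r addr0.
- by move=> k p _; rewrite !mulr_algl !mulr_algr mul0r mulr0 add0r addr0.
- by move=> x y; rewrite lactD !linearD.
- by move=> k x; rewrite lactZ !linearZ /= !mulr_algl mul0r add0r.
- move=> x y; rewrite lact_der linearD /= !ugen_lie -[RHS]/(_, _) /=; congr pair.
  by rewrite opprD addrACA [ - _ - _]addrC addrACA.
Qed.

Definition uder (u : a) (f : Ug) : Ug :=
  (ueval (fun k : K => (k%:A, 0)) (sqz_gen u) sqz_mul (urepr f)).2.

Let sqz_eval u := ueval (fun k : K => (k%:A, 0) : Ug * Ug) (sqz_gen u) sqz_mul.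
Let uder_pi u t : uder u (upi t) = (sqz_eval u t).2.
Proof. by rewrite /uder (ueval_repr (sqz_model u)). Qed.
Let sqz_eval1 u t : (sqz_eval u t).1 = upi t.
Proof.
elim: t => [k|x|s hs t ht|s hs t ht] //=; first by rewrite upi_const.
- by rewrite hs ht upi_add.
- by rewrite hs ht upi_mul.
Qed.

Lemma uder_gen u x : uder u (ugen x) = ugen (M x u).
Proof. exact: uder_pi u (UGen x). Qed.
Lemma uderM u f f' : uder u (f * f') = uder u f * f' + f * uder u f'.
Proof.
elim/upiW: f => s; elim/upiW: f' => t.
by rewrite -upi_mul !uder_pi /= !sqz_eval1.
Qed.
Fact uder_linear u : linear (uder u).
Proof.
move=> c; elim/upiW=> s; elim/upiW=> t.
rewrite -mulr_algl -upi_const -upi_mul -upi_add !uder_pi /=.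
by rewrite mul0r add0r mulr_algl.
Qed.
HB.instance Definition _ u := GRing.isLinear.Build K Ug Ug *:%R (uder u) (uder_linear u).
Lemma uder1 u : uder u 1 = 0.
Proof. exact: uder_pi u (UConst g 1). Qed.

Lemma uder_linearr c u v f : uder (c *: u + v) f = c *: uder u f + uder v f.
Proof.
elim/Uenv_ind: f => [|x|f f' hf hf'|d f hf|f f' hf hf'].
- by rewrite !uder1 scaler0 addr0.
- by rewrite !uder_gen lact_linearr linearP.
- by rewrite !linearD /= hf hf' addrACA -scalerDr.
- by rewrite !linearZ /= hf scalerDr !scalerA mulrC.
- rewrite !uderM hf hf' mulrDl mulrDr -scalerAl -scalerAr scalerDr.
  by rewrite addrACA.
Qed.

Lemma uder_lie u v f : uder (lie u v) f = uder v (uder u f) - uder u (uder v f).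
Proof.
elim/Uenv_ind: f => [|x|f f' hf hf'|d f hf|f f' hf hf'].
- by rewrite !uder1 (linear0 (uder u)) (linear0 (uder v)) subr0.
- by rewrite !uder_gen lact_lie linearB.
- by rewrite !linearD /= hf hf' addrACA.
- by rewrite !linearZ /= hf scalerDr.
- rewrite !uderM hf hf' (linearD (uder v)) (linearD (uder u)) /= !uderM mulrBl mulrBr.
  set p := uder v (uder u f) * f'; set q := uder u (uder v f) * f'.
  set r := f * uder v (uder u f'); set s := f * uder u (uder v f').
  set x := uder u f * uder v f'; set y := uder v f * uder u f'.
  rewrite [y + r]addrC [p + x + _]addrACA [x + s]addrC [q + y + _]addrACA [y + x]addrC.
  by rewrite [in RHS]opprD [RHS]addrACA subrr addr0 opprD addrACA.
Qed.

Lemma act_model : umodel (fun F : Ug -> Ug => linear F)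
  (fun (k : K) f => k *: f) uder (fun F G f => G (F f)).
Proof.
split=> //.
- by move=> k c x y; rewrite scalerDr !scalerA mulrC.
- by move=> u; exact: uder_linear.
- by move=> F G hF hG c x y; rewrite /GRing.add /= hF hG scalerDr addrACA.
- by move=> F G hF hG c x y; rewrite hF hG.
- by move=> F hF; apply/funext => f; rewrite scale1r.
- move=> F G H hF hG hH; apply/funext => f.
  by have := hH 1 (F f) (G f); rewrite !scale1r.
- by move=> k l; apply/funext => f; rewrite scalerDl.
- by move=> k l; apply/funext => f; rewrite scalerA mulrC.
- move=> k F hF; apply/funext => f.
  have F0 : F 0 = 0.
    have := hF 1 0 0; rewrite !scale1r addr0 => h.
    by apply: (addrI (F 0)); rewrite -h addr0.
  by have := hF k f 0; rewrite F0 !addr0.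
- move=> u v; apply/funext => f.
  by have := uder_linearr 1 u v f; rewrite !scale1r.
- move=> k u; apply/funext => f; rewrite linearZ /=.
  have h0 : uder 0 f = 0.
    have := uder_linearr 1 0 0 f; rewrite !scale1r addr0 => h.
    by apply: (addrI (uder 0 f)); rewrite -h addr0.
  by have := uder_linearr k u 0 f; rewrite h0 !addr0.
- by move=> u v; apply/funext => f; rewrite uder_lie.
Qed.

(* The right action of the algebra Ua on Ug in which each u : a acts by the
   derivation uder u; it is pinned down by uact1, uactM, uact_gen, uact_linearl
   and uact_linearr. *)
Definition uact (f : Ug) (A : Ua) : Ug :=
  ueval (fun (k : K) f => k *: f) uder (fun F G f => G (F f)) (urepr A) f.

Let uact_pi f t : uact f (upi t) =
  ueval (fun (k : K) f => k *: f) uder (fun F G f => G (F f)) t f.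
Proof. by rewrite /uact (ueval_repr act_model). Qed.

Lemma uact_linearl A : linear (uact^~ A).
Proof. by move=> c x y; exact: (ueval_P act_model (urepr A) c x y). Qed.
Lemma uact_linearr f : linear (uact f).
Proof.
move=> c; elim/upiW=> s; elim/upiW=> t.
rewrite -mulr_algr -upi_const -upi_mul -upi_add !uact_pi.
by rewrite -[LHS]/(_ + _).
Qed.
Lemma uact1 f : uact f 1 = f.
Proof. by rewrite -[1]/(upi (UConst a 1)) uact_pi /= scale1r. Qed.
Lemma uactM f A B : uact f (A * B) = uact (uact f A) B.
Proof. by elim/upiW: A => s; elim/upiW: B => t; rewrite -upi_mul !uact_pi. Qed.
Lemma uact_gen f u : uact f (ugen u) = uder u f.
Proof. exact: uact_pi f (UGen u). Qed.

Record is_hopf_O_operator (T : {linear Ug -> Ua}) : Prop := {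
  hopfO_coprod : forall f, coprod (T f) = \sw_(f1, f2 <- f) (T f1 \ox T f2);
  hopfO_counit : forall f, counit (T f) = counit f;
  hopfO_mul : forall e f,
    T e * T f = T (\sw_(f1, f2 <- f) (uact e (T f1) * f2))
}.

Definition sharp (A B : Ug -> Ua) (f : Ug) : Ua :=
  \sw_(f1, f2 <- f) \sw_(b1, b2 <- B f2) (A (uact f1 (antipode b1)) * b2).
End Action.

Section Convolution.
Variables (K : fieldType) (g : lieAlgType K) (A : algType K).

Definition conv (phi psi : Uenv g -> A) (f : Uenv g) : A :=
  \sw_(f1, f2 <- f) (phi f1 * psi f2).

(* eta o epsilon, the unit of both conv and sharp *)
Definition conv_unit (f : Uenv g) : A := (counit f)%:A.

Definition conv_pow (phi : Uenv g -> A) (n : nat) : Uenv g -> A :=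
  iter n (conv^~ phi) conv_unit.

Lemma conv_bilin (phi psi : Uenv g -> A) : linear phi -> linear psi ->
  bilin (fun f1 f2 => phi f1 * psi f2).
Proof.
move=> hp hq; split=> [w c v v'|v c w w'].
- by rewrite hp mulrDl -scalerAl.
- by rewrite hq mulrDr -scalerAr.
Qed.

Lemma conv_linear (phi psi : Uenv g -> A) : linear phi -> linear psi ->
  linear (conv phi psi).
Proof.
move=> hp hq c u v; rewrite /conv /sweedler linearP.
exact: tlift_lin (conv_bilin hp hq) _ _ _.
Qed.

Lemma conv_unit_linear : linear conv_unit.
Proof. by move=> c u v; rewrite /conv_unit linearP scalerDl scalerA. Qed.

Lemma conv_pow_linear phi n : linear phi -> linear (conv_pow phi n).
Proof.
by move=> hp; elim: n => [|n ih]; [exact: conv_unit_linear|exact: conv_linear].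
Qed.
End Convolution.

Section Solomon.
Variables (K : fieldType) (g : lieAlgType K).
Local Notation U := (Uenv g).

Definition augm (f : U) : U := f - conv_unit U f.

Lemma augm_linear : linear augm.
Proof.
move=> c u v; rewrite /augm (@conv_unit_linear _ g U) scalerBr opprD.
by rewrite addrACA.
Qed.

(* In sol1 and exp_sharp below, the sum over n is the library's finitely supported
   sum, which is 0 by convention when the support is infinite;
   sol1_locally_finite rules this out for sol1. *)
Definition sol1 (f : U) : U :=
  \sum_(n \in [set n | (0 < n)%N]) ((-1) ^+ n.-1 / n%:R) *: conv_pow augm n f.

Definition sol (n : nat) (f : U) : U := n`!%:R^-1 *: conv_pow sol1 n f.

Inductive ufil : nat -> U -> Prop :=
  | ufil_1 k : ufil k 1
  | ufil_add k u v : ufil k u -> ufil k v -> ufil k (u + v)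
  | ufil_scale k c u : ufil k u -> ufil k (c *: u)
  | ufil_gen k x u : ufil k u -> ufil k.+1 (ugen x * u).

Inductive tfil (k : nat) : tensor U U -> Prop :=
  | tfil_tens i j u v : (i + j)%N = k -> ufil i u -> ufil j v -> tfil k (u \ox v)
  | tfil_add s t : tfil k s -> tfil k t -> tfil k (s + t)
  | tfil_scale c s : tfil k s -> tfil k (c *: s).

Lemma ufil_mul i j u v : ufil i u -> ufil j v -> ufil (i + j) (u * v).
Proof.
move=> hu hv; elim: hu => {i u} [k|k u u' _ hu _ hu'|k c u _ hu|k x u _ hu].
- rewrite mul1r; elim: k => [|k ih]; first by [].
  rewrite addSn; elim: {hv} ih => {}k.
  + exact: ufil_1.
  + by move=> *; apply: ufil_add.
  + by move=> *; apply: ufil_scale.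
  + by move=> *; apply: ufil_gen.
- by rewrite mulrDl; exact: ufil_add.
- by rewrite -scalerAl; exact: ufil_scale.
- by rewrite -mulrA addSn; exact: ufil_gen.
Qed.

Lemma ufilS k u : ufil k u -> ufil k.+1 u.
Proof. by move=> h; rewrite -[u]mul1r; exact: ufil_mul (ufil_1 1) h. Qed.
Lemma ufilW i k u : (i <= k)%N -> ufil i u -> ufil k u.
Proof.
by move=> h hu; rewrite -(subnK h) -[u]mul1r; apply: ufil_mul => //; exact: ufil_1.
Qed.

Lemma ufil_ex u : exists k, ufil k u.
Proof.
elim/Uenv_ind: u => [|x|u v [i hu] [j hv]|c u [i hu]|u v [i hu] [j hv]].
- by exists 0; exact: ufil_1.
- by exists 1; rewrite -[ugen x]mulr1; exact: ufil_gen (ufil_1 0).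
- exists (i + j)%N; apply: ufil_add.
  + by apply: ufilW hu; rewrite leq_addr.
  + by apply: ufilW hv; rewrite leq_addl.
- by exists i; exact: ufil_scale.
- by exists (i + j)%N; exact: ufil_mul.
Qed.

Lemma tfil_prim k x t : tfil k t -> tfil k.+1 (prim x * t).
Proof.
elim=> {t} [i j u v <- hu hv|s t _ hs _ ht|c s _ hs].
- rewrite /prim mulrDl !tensM !mul1r; apply: tfil_add.
  + by apply: (@tfil_tens _ i.+1 j) => //; exact: ufil_gen.
  + by apply: (@tfil_tens _ i j.+1); rewrite ?addnS //; exact: ufil_gen.
- by rewrite mulrDr; exact: tfil_add.
- by rewrite -tens_scaleAr; exact: tfil_scale.
Qed.

Lemma coprod_fil k u : ufil k u -> tfil k (coprod u).
Proof.
elim=> {k u} [k|k u v _ hu _ hv|k c u _ hu|k x u _ hu].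
- rewrite rmorph1; apply: (@tfil_tens _ k 0); rewrite ?addn0 //; exact: ufil_1.
- by rewrite linearD; exact: tfil_add.
- by rewrite linearZ; exact: tfil_scale.
- by rewrite rmorphM /= coprod_gen; exact: tfil_prim.
Qed.

Lemma augm_ufil0 k u : ufil k u -> k = 0%N -> augm u = 0.
Proof.
elim=> {k u} [k|k u v _ hu _ hv|k c u _ hu|//] k0.
- by rewrite /augm /conv_unit rmorph1 scale1r subrr.
- by have := augm_linear 1 u v; rewrite !scale1r hu // hv // addr0.
- have := augm_linear c u 0; rewrite addr0 hu // scaler0 add0r => ->.
  by rewrite /augm /conv_unit linear0 scale0r subrr.
Qed.

Lemma augm_pow_fil n k u : ufil k u -> (k < n)%N -> conv_pow augm n u = 0.
Proof.
elim: n k u => [//|n ih] k u hu kn.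
have hb := conv_bilin (conv_pow_linear n augm_linear) augm_linear.
rewrite /conv_pow iterS -/(conv_pow augm n) /conv /sweedler.
elim: (coprod_fil hu) => [i j v w ijk hv hw|s t _ hs _ ht|c s _ hs].
- rewrite (tlift_tens hb); case: (ltnP i n) => [lin|lni].
    by rewrite (ih i) // mul0r.
  have j0 : j = 0%N.
    apply/eqP; rewrite -leqn0 -(leq_add2l n) addn0.
    by rewrite (leq_trans (leq_add lni (leqnn j))) // ijk.
  by rewrite (augm_ufil0 hw j0) mulr0.
- by rewrite (tliftD hb) hs ht addr0.
- by rewrite (tliftZ hb) hs scaler0.
Qed.

Lemma sol1_locally_finite f :
  exists N, forall n, (N <= n)%N -> conv_pow augm n f = 0.
Proof.
by have [k hk] := ufil_ex f; exists k.+1 => n; exact: augm_pow_fil hk.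
Qed.

End Solomon.

Section ExpSharp.
Variables (K : fieldType) (g a : lieAlgType K) (M : rightLieModule g a).

Definition sharp_pow (alpha : Uenv g -> Uenv a) (n : nat) : Uenv g -> Uenv a :=
  iter n ((sharp M)^~ alpha) (conv_unit (Uenv a)).

Definition exp_sharp (alpha : Uenv g -> Uenv a) (f : Uenv g) : Uenv a :=
  conv_unit (Uenv a) f +
  \sum_(n \in [set n | (0 < n)%N]) n`!%:R^-1 *: sharp_pow alpha n f.

End ExpSharp.

(* Main.v *)
(* An element p is primitive if Delta p = p (x) 1 + 1 (x) p.  Each sol_1(f) is
   primitive, and T maps primitives to primitives, so every Gamma_1(f) is
   primitive in U(a).  For primitive p the defining identity of T reads
   T(e p) = T(e) T(p) - T(e <| T(p)); inserting e = sol_n(f_(1)), p = sol_1(f_(2))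
   and moving the action through sol_n, which commutes with it, gives the
   recursion for Gamma_(n+1).  Since the antipode is -1 on primitives, its
   right-hand side is Gamma_n # Gamma_1, whence Gamma_n = Gamma_1^{#n} / n!, and
   id = exp(log id) = sum_n sol_n yields the exponential formula.

   Primitivity of sol_1 comes from the Adams operations Psi^k = id^{.k}, which are
   coalgebra maps because U(g) is cocommutative: on each filtration step
   Psi^k = sum_i C(k, i) J^{.i} with J = id - eta epsilon, so Psi^k(f) is polynomial
   in k with linear coefficient sol_1(f), and comparing linear coefficients in
   Delta Psi^k(f) = Psi^k(f_(1)) (x) Psi^k(f_(2)) gives the claim. *)
Require Import Defs.
From HB Require Import structures.
From mathcomp Require Import all_boot all_order all_algebra.
From mathcomp Require Import boolp classical_sets functions cardinality fsbigop.
Import GRing.Theory.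
Local Open Scope ring_scope.

Set Implicit Arguments.
Unset Strict Implicit.

#[local] Arguments conv_pow : simpl never.

(** * Elementary consequences of linearity for unbundled maps *)

Section LinearFunctions.
Variables (K : fieldType) (V W : lmodType K) (h : V -> W).
Hypothesis hl : linear h.

Lemma linear_fun0 : h 0 = 0.
Proof. by have := hl (-1) 0 0; rewrite scaleN1r addNr scaleN1r addNr. Qed.

Lemma linear_funD x y : h (x + y) = h x + h y.
Proof. by have := hl 1 x y; rewrite !scale1r. Qed.

Lemma linear_funZ c x : h (c *: x) = c *: h x.
Proof. by have := hl c x 0; rewrite linear_fun0 !addr0. Qed.

Lemma linear_funN x : h (- x) = - h x.
Proof. by rewrite -scaleN1r linear_funZ scaleN1r. Qed.

Lemma linear_fun_sumZ n (c : 'I_n -> K) (x : 'I_n -> V) :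
  h (\sum_(i < n) c i *: x i) = \sum_(i < n) c i *: h (x i).
Proof. by elim/big_rec2: _ => [|i y z _ <-]; [exact: linear_fun0|exact: hl]. Qed.
End LinearFunctions.

(** * Sweedler calculus and Hopf algebra identities in U(g) *)

Section Sweedler.
Variables (K : fieldType) (g : lieAlgType K).
Local Notation U := (Uenv g).

(** Words in the generators span U(g), as [ufil_ex] records. Peeling off one generator at a time
    suits coproduct identities, since [sweedler_gen] then gives the induction step. *)
Lemma Uenv_gen_ind (P : U -> Prop) :
  P 1 -> (forall c u v, P u -> P v -> P (c *: u + v)) ->
  (forall x u, P u -> P (ugen x * u)) -> forall u, P u.
Proof.
move=> h1 hL hx u; have [k] := ufil_ex u.
have h0 : P 0 by rewrite -[0](addNr 1) -scaleN1r; exact: hL.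
elim=> {k u} // [k u v _ hu _ hv|k c u _ hu|k x u _ hu].
- by rewrite -[u]scale1r; exact: hL.
- by rewrite -[_ *: _]addr0; exact: hL.
- exact: hx.
Qed.

Lemma eq_sweedler (X : lmodType K) (b b' : U -> U -> X) f :
  (forall p q, b p q = b' p q) -> sweedler b f = sweedler b' f.
Proof. exact: eq_tlift. Qed.

(** Both sides evaluate the same chosen representative of [coprod f], and [F] passes through its
    sums and scalings. *)
Lemma sweedler_linear_map (X Y : lmodType K) (F : X -> Y) (b : U -> U -> X) f :
  linear F -> F (sweedler b f) = sweedler (fun p q => F (b p q)) f.
Proof.
move=> hF; rewrite /sweedler /tlift.
by elim: (trepr _) => //= [s <- t <-|c s <-]; rewrite (linear_funD, linear_funZ).
Qed.

Lemma sweedler_pointwise (X : lmodType K) c (b b' : U -> U -> X) f :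
  \sw_(p, q <- f) (c *: b p q + b' p q) = c *: sweedler b f + sweedler b' f.
Proof.
rewrite /sweedler /tlift; elim: (trepr _) => //= [s -> t ->|d s ->].
- by rewrite scalerDr addrACA.
- by rewrite scalerDr !scalerA mulrC.
Qed.

Lemma sweedler_linear (X : lmodType K) (b : U -> U -> X) :
  bilin b -> linear (sweedler b).
Proof. by move=> hb c u v; rewrite /sweedler linearP (tlift_lin hb). Qed.

Lemma sweedler1 (X : lmodType K) (b : U -> U -> X) : bilin b -> sweedler b 1 = b 1 1.
Proof. by move=> hb; rewrite /sweedler rmorph1 (tlift_tens hb). Qed.

Lemma sweedler_primitive (X : lmodType K) (b : U -> U -> X) p : bilin b ->
  coprod p = p \ox 1 + 1 \ox p -> sweedler b p = b p 1 + b 1 p.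
Proof. by move=> hb hp; rewrite /sweedler hp (tliftD hb) !(tlift_tens hb). Qed.

Lemma bilinP (X : lmodType K) (b : U -> U -> X) :
  (forall w, linear (b^~ w)) -> (forall v, linear (b v)) -> bilin b.
Proof. by move=> hl hr; split=> *; rewrite (hl, hr). Qed.

(** The coproduct is multiplicative and [ugen x] is primitive, so its two summands act on the two
    tensor factors. *)
Lemma sweedler_gen (X : lmodType K) (b : U -> U -> X) x f : bilin b ->
  sweedler b (ugen x * f) =
  \sw_(p, q <- f) b (ugen x * p) q + \sw_(p, q <- f) b p (ugen x * q).
Proof.
move=> hb; rewrite /sweedler rmorphM /= coprod_gen.
have hl : bilin (fun p q => b (ugen x * p) q).
  by split=> *; rewrite ?mulrDr -?scalerAr (hb.1, hb.2).
have hr : bilin (fun p q => b p (ugen x * q)).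
  by split=> *; rewrite ?mulrDr -?scalerAr (hb.1, hb.2).
elim/tens_ind: (coprod f) => [p q|s t hs ht|c s hs].
- rewrite mulrDl !tensM !mul1r (tliftD hb) (tlift_tens hb).
  by rewrite (tlift_tens hb) (tlift_tens hl) (tlift_tens hr).
- by rewrite mulrDr (tliftD hb) hs ht (tliftD hl) (tliftD hr) addrACA.
- by rewrite -tens_scaleAr (tliftZ hb) hs (tliftZ hl) (tliftZ hr) scalerDr.
Qed.

Lemma mulr_linearr (x : U) : linear ( *%R x).
Proof. by move=> c u v; rewrite mulrDr -scalerAr. Qed.
Lemma mulr_linearl (x : U) : linear ( *%R^~ x).
Proof. by move=> c u v; rewrite mulrDl -scalerAl. Qed.

Lemma sweedlerD (X : lmodType K) (b b' : U -> U -> X) f :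
  \sw_(p, q <- f) (b p q + b' p q) = sweedler b f + sweedler b' f.
Proof.
rewrite -[sweedler b f]scale1r -sweedler_pointwise.
by apply: eq_sweedler => *; rewrite scale1r.
Qed.

Lemma sweedler0 (X : lmodType K) (f : U) : \sw_(p, q <- f) (0 : X) = 0.
Proof.
by apply: (addrI (\sw_(p, q <- f) (0 : X))); rewrite -sweedlerD !addr0.
Qed.

Lemma sweedler_counitl (X : lmodType K) (h : U -> X) f : linear h ->
  \sw_(p, q <- f) (counit p *: h q) = h f.
Proof.
have hb (h' : U -> X) : linear h' -> bilin (fun p q : U => counit p *: h' q).
  move=> hh; apply: bilinP => v c p q; first by rewrite linearP scalerDl scalerA.
  by rewrite hh scalerDr !scalerA mulrC.
elim/Uenv_gen_ind: f h => [|c u v hu hv|x u hu] h hh.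
- by rewrite sweedler1 ?rmorph1 ?scale1r //; exact: hb.
- by rewrite (sweedler_linear (hb _ hh)) hu // hv // hh.
- rewrite (sweedler_gen _ _ (hb _ hh)) (hu (fun q => h (ugen x * q))); last first.
    by move=> c p q; rewrite mulr_linearr hh.
  rewrite (eq_sweedler (b' := fun _ _ => 0)) ?sweedler0 ?add0r // => p q.
  by rewrite rmorphM /= counit_gen mul0r scale0r.
Qed.

(* Coassociativity of the coproduct, tested on trilinear maps. *)
Lemma sweedlerA (X : lmodType K) (t : U -> U -> U -> X) f :
  (forall q r, linear (fun p => t p q r)) -> (forall p r, linear (fun q => t p q r)) ->
  (forall p q, linear (t p q)) ->
  \sw_(p, r <- f) \sw_(p1, p2 <- p) t p1 p2 r =
  \sw_(p, r <- f) \sw_(r1, r2 <- r) t p r1 r2.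
Proof.
have hl (t' : U -> U -> U -> X) : (forall q r, linear (fun p => t' p q r)) ->
    (forall p r, linear (fun q => t' p q r)) -> (forall p q, linear (t' p q)) ->
    bilin (fun p r => \sw_(p1, p2 <- p) t' p1 p2 r).
  move=> h1 h2 h3; apply: bilinP => [r|p] c u v.
    by apply: sweedler_linear; exact: bilinP.
  by rewrite -sweedler_pointwise; apply: eq_sweedler => *; rewrite h3.
have hr (t' : U -> U -> U -> X) : (forall q r, linear (fun p => t' p q r)) ->
    (forall p r, linear (fun q => t' p q r)) -> (forall p q, linear (t' p q)) ->
    bilin (fun p r => \sw_(r1, r2 <- r) t' p r1 r2).
  move=> h1 h2 h3; apply: bilinP => [r|p] c u v.
    by rewrite -sweedler_pointwise; apply: eq_sweedler => *; rewrite h1.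
  by apply: sweedler_linear; exact: bilinP.
elim/Uenv_gen_ind: f t => [|c u v hu hv|x u hu] t h1 h2 h3.
- by rewrite !sweedler1; auto using bilinP.
- by rewrite (sweedler_linear (hl _ h1 h2 h3)) (sweedler_linear (hr _ h1 h2 h3)) hu ?hv.
- rewrite (sweedler_gen _ _ (hl _ h1 h2 h3)) (sweedler_gen _ _ (hr _ h1 h2 h3)).
  under eq_sweedler => p q do [rewrite sweedler_gen; last exact: bilinP].
  under [X in _ = _ + X]eq_sweedler => p q
    do [rewrite sweedler_gen; last exact: bilinP].
  rewrite !sweedlerD -addrA; congr (_ + (_ + _)).
  + by apply: (hu (fun p q r => t (ugen x * p) q r)) => // q r c p p';
      rewrite mulr_linearr h1.
  + by apply: (hu (fun p q r => t p (ugen x * q) r)) => // q r c p p';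
      rewrite mulr_linearr h2.
  + by apply: (hu (fun p q r => t p q (ugen x * r))) => // q r c p p';
      rewrite mulr_linearr h3.
Qed.

(* (Delta (x) Delta) Delta is invariant under swapping the two middle tensor
   factors, tested on quadrilinear maps. *)
Lemma sweedler_exchange (X : lmodType K) (t : U -> U -> U -> U -> X) f :
  (forall q r s, linear (fun p => t p q r s)) ->
  (forall p r s, linear (fun q => t p q r s)) ->
  (forall p q s, linear (fun r => t p q r s)) ->
  (forall p q r, linear (t p q r)) ->
  \sw_(a, b <- f) \sw_(p, q <- a) \sw_(r, s <- b) t p q r s =
  \sw_(a, b <- f) \sw_(p, q <- a) \sw_(r, s <- b) t p r q s.
Proof.
pose multilin (t : U -> U -> U -> U -> X) := [/\
  forall q r s, linear (fun p => t p q r s), forall p r s, linear (fun q => t p q r s),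
  forall p q s, linear (fun r => t p q r s) & forall p q r, linear (t p q r)].
have hi t' b : multilin t' -> bilin (fun p q => \sw_(r, s <- b) t' p q r s).
  case=> h1 h2 h3 h4; apply: bilinP => p c u v;
  by rewrite -sweedler_pointwise; apply: eq_sweedler => *; rewrite (h1, h2).
have ho t' : multilin t' ->
    bilin (fun a b => \sw_(p, q <- a) \sw_(r, s <- b) t' p q r s).
  move=> h; apply: bilinP => [b|a] c u v; first by apply: sweedler_linear; exact: hi.
  case: h => h1 h2 h3 h4; rewrite -sweedler_pointwise; apply: eq_sweedler => *.
  by apply: sweedler_linear; exact: bilinP.
have swapP t' : multilin t' -> multilin (fun p q r s => t' p r q s) by case.
have step t' x u : multilin t' ->
    \sw_(a, b <- ugen x * u) \sw_(p, q <- a) \sw_(r, s <- b) t' p q r s =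
    \sw_(a, b <- u) \sw_(p, q <- a) \sw_(r, s <- b) t' (ugen x * p) q r s +
    \sw_(a, b <- u) \sw_(p, q <- a) \sw_(r, s <- b) t' p (ugen x * q) r s +
    \sw_(a, b <- u) \sw_(p, q <- a) \sw_(r, s <- b) t' p q (ugen x * r) s +
    \sw_(a, b <- u) \sw_(p, q <- a) \sw_(r, s <- b) t' p q r (ugen x * s).
  move=> h; rewrite (sweedler_gen _ _ (ho _ h)) -[RHS]addrA.
  congr (_ + _); rewrite -sweedlerD; apply: eq_sweedler => a b.
    by rewrite sweedler_gen //; exact: hi.
  rewrite -sweedlerD; apply: eq_sweedler => p q; rewrite sweedler_gen //.
  by case: h => *; exact: bilinP.
move=> h1 h2 h3 h4; have h : multilin t by [].
move: h {h1 h2 h3 h4}.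
elim/Uenv_gen_ind: f t => [|c u v hu hv|x u hu] t h.
- rewrite (sweedler1 (ho _ h)) (sweedler1 (ho _ (swapP _ h))).
  rewrite (sweedler1 (hi _ 1 h)) (sweedler1 (hi _ 1 (swapP _ h))).
  case: h => h1 h2 h3 h4; rewrite !sweedler1 //; exact: bilinP.
- by rewrite (sweedler_linear (ho _ h)) (sweedler_linear (ho _ (swapP _ h)))
    (hu _ h) (hv _ h).
- rewrite (step _ _ _ h) (step _ _ _ (swapP _ h)) [X in _ = X + _]addrAC.
  case: h => h1 h2 h3 h4; have hx := mulr_linearr (ugen x).
  congr (_ + _ + _ + _).
  + by apply: (hu (fun p q r s => t (ugen x * p) q r s));
      split=> ? ? ? c y z; rewrite ?hx (h1, h2, h3, h4).
  + by apply: (hu (fun p q r s => t p (ugen x * q) r s));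
      split=> ? ? ? c y z; rewrite ?hx (h1, h2, h3, h4).
  + by apply: (hu (fun p q r s => t p q (ugen x * r) s));
      split=> ? ? ? c y z; rewrite ?hx (h1, h2, h3, h4).
  + by apply: (hu (fun p q r s => t p q r (ugen x * s)));
      split=> ? ? ? c y z; rewrite ?hx (h1, h2, h3, h4).
Qed.

Lemma sweedler_counitr (X : lmodType K) (h : U -> X) f : linear h ->
  \sw_(p, q <- f) (counit q *: h p) = h f.
Proof.
have hb (h' : U -> X) : linear h' -> bilin (fun p q : U => counit q *: h' p).
  move=> hh; apply: bilinP => v c p q; last by rewrite linearP scalerDl scalerA.
  by rewrite hh scalerDr !scalerA mulrC.
elim/Uenv_gen_ind: f h => [|c u v hu hv|x u hu] h hh.
- by rewrite sweedler1 ?rmorph1 ?scale1r //; exact: hb.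
- by rewrite (sweedler_linear (hb _ hh)) hu // hv // hh.
- rewrite (sweedler_gen _ _ (hb _ hh)) (hu (fun q => h (ugen x * q))); last first.
    by move=> c p q; rewrite mulr_linearr hh.
  rewrite (eq_sweedler (b := fun p q => counit (_ * _) *: _) (b' := fun _ _ => 0))
    ?sweedler0 ?addr0 // => p q.
  by rewrite rmorphM /= counit_gen mul0r scale0r.
Qed.

Lemma antipode_mul_bilin : bilin (fun p q : U => antipode p * q).
Proof.
by apply: bilinP => v c p q; rewrite ?mulr_linearr // linearP mulr_linearl.
Qed.

(** On [ugen x * u] the two halves of the coproduct contribute S(p)(-x)q and S(p)xq, which
    cancel. *)
Lemma sweedler_antipode (f : U) : \sw_(p, q <- f) (antipode p * q) = (counit f)%:A.
Proof.
have hb := antipode_mul_bilin.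
elim/Uenv_gen_ind: f => [|c u v hu hv|x u hu].
- by rewrite sweedler1 // antipode1 mul1r rmorph1 scale1r.
- by rewrite (sweedler_linear hb) hu hv linearP scalerDl scalerA.
- rewrite (sweedler_gen _ _ hb) -sweedlerD rmorphM /= counit_gen mul0r scale0r.
  rewrite -[RHS](sweedler0 _ u); apply: eq_sweedler => p q.
  by rewrite antipodeM antipode_gen mulrN mulNr mulrA addNr.
Qed.

(** The counit axiom at a primitive [p] reads [counit p *: 1 + p = p]. *)
Lemma counit_primitive (p : U) : coprod p = p \ox 1 + 1 \ox p -> counit p = 0.
Proof.
have hb : bilin (fun p q : U => counit p *: q).
  apply: bilinP => v c r q; first by rewrite linearP scalerDl scalerA.
  by rewrite scalerDr !scalerA mulrC.
move=> hp; have := sweedler_counitl p (h := id) (fun _ _ _ => erefl).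
rewrite (sweedler_primitive hb hp) rmorph1 scale1r -[RHS]add0r.
move=> /addIr /(congr1 (@counit K g)).
by rewrite linearZ /= rmorph1 mulr1 linear0.
Qed.

Lemma antipode_primitive (p : U) : coprod p = p \ox 1 + 1 \ox p -> antipode p = - p.
Proof.
have hb := antipode_mul_bilin.
move=> hp; have := sweedler_antipode p; rewrite (sweedler_primitive hb hp).
rewrite counit_primitive // scale0r mulr1 antipode1 mul1r => /eqP.
by rewrite addr_eq0 => /eqP.
Qed.

(** The antipode axiom makes [antipode u] a left inverse of a grouplike [u], so [u * u = u] can be
    cancelled. This will give [T 1 = 1]. *)
Lemma grouplike_idempotent (u : U) :
  coprod u = u \ox u -> counit u = 1 -> u * u = u -> u = 1.
Proof.
have hb := antipode_mul_bilin.
move=> hu hc huu; have := sweedler_antipode u.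
rewrite /sweedler hu (tlift_tens hb) hc scale1r => h.
by rewrite -h -{3}huu mulrA h mul1r.
Qed.

End Sweedler.

(** * The convolution algebra of linear maps U(g) -> A *)

Section Convolution.
Variables (K : fieldType) (g : lieAlgType K) (A : algType K).
Local Notation U := (Uenv g).
Implicit Types phi psi chi : U -> A.

Lemma convA phi psi chi : linear phi -> linear psi -> linear chi ->
  conv (conv phi psi) chi =1 conv phi (conv psi chi).
Proof.
move=> h1 h2 h3 f; rewrite /conv.
transitivity (\sw_(p, r <- f) \sw_(p1, p2 <- p) (phi p1 * psi p2 * chi r)).
  apply: eq_sweedler => p q.
  apply: (sweedler_linear_map (F := *%R^~ (chi q))) => c x y.
  by rewrite mulrDl -scalerAl.
rewrite sweedlerA.
- apply: eq_sweedler => p q; rewrite [RHS](sweedler_linear_map (F := *%R (phi p))).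
    by apply: eq_sweedler => *; rewrite mulrA.
  by move=> c x y; rewrite mulrDr -scalerAr.
- by move=> q r c x y; rewrite h1 !mulrDl -!scalerAl.
- by move=> q r c x y; rewrite h2 mulrDr -scalerAr mulrDl -scalerAl.
- by move=> q r c x y; rewrite h3 mulrDr -scalerAr.
Qed.

Lemma conv_unitr phi : linear phi -> conv phi (conv_unit A) =1 phi.
Proof.
move=> h f; rewrite -[RHS](sweedler_counitr f h); apply: eq_sweedler => p q.
by rewrite /conv_unit mulr_algr.
Qed.

Lemma conv_unitl phi : linear phi -> conv (conv_unit A) phi =1 phi.
Proof.
move=> h f; rewrite -[RHS](sweedler_counitl f h); apply: eq_sweedler => p q.
by rewrite /conv_unit mulr_algl.
Qed.

Lemma eq_conv phi phi' psi psi' : phi =1 phi' -> psi =1 psi' ->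
  conv phi psi =1 conv phi' psi'.
Proof. by move=> h h' f; apply: eq_sweedler => p q; rewrite h h'. Qed.

End Convolution.

(** * Coefficients of binomials, logarithm and exponential in characteristic zero *)

Section Coefficients.
Variable K : fieldType.
Hypothesis charK0 : [pchar K] =i pred0.

Lemma natr_neq0 n : n.+1%:R != 0 :> K.
Proof. by have /pcharf0P -> := charK0. Qed.

Lemma fact_neq0 n : n`!%:R != 0 :> K.
Proof. by have /pcharf0P -> := charK0; rewrite -lt0n fact_gt0. Qed.

(* Inverting a Vandermonde matrix expresses the linear coefficient as a
   combination of the values at 0, ..., n - 1. *)
Lemma coef1_from_values n : (1 < n)%N ->
  exists c : 'I_n -> K, forall p : {poly K}, (size p <= n)%N ->
    \sum_(k < n) c k * p.[k%:R] = p`_1.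
Proof.
move=> n1; pose V := Vandermonde n (\row_(j < n) (j%:R : K)).
(* The nodes 0, ..., n - 1 are distinct in characteristic zero. *)
have Vu : V \in unitmx.
  rewrite unitmxE unitfE det_Vandermonde; apply/prodf_neq0 => i _.
  apply/prodf_neq0 => j ij; rewrite !mxE -natrB; last exact: ltnW.
  by rewrite -subn_gt0 in ij; rewrite -(prednK ij) natr_neq0.
(* The weights form column 1 of the inverse matrix, hence pick out the coefficient of degree 1. *)
exists (fun k => invmx V k (Ordinal n1)) => p sp.
transitivity (\sum_(i < n) p`_i * (V *m invmx V) i (Ordinal n1)).
  under eq_bigr => k _ do rewrite (horner_coef_wide _ sp) mulr_sumr.
  rewrite exchange_big; apply: eq_bigr => i _; rewrite mxE mulr_sumr.
  by apply: eq_bigr => k _; rewrite mulrCA [V i k]mxE mxE [_ ^+ _ * _]mulrC.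
rewrite (mulmxV Vu) (bigD1 (Ordinal n1)) //= mxE eqxx mulr1 big1 ?addr0 // => i hi.
by rewrite mxE (negbTE hi) mulr0.
Qed.

(** The binomial coefficient C(X, i) as a polynomial in its upper argument. *)
Definition binom_poly i : {poly K} := i`!%:R^-1 *: \prod_(m < i) ('X - m%:R%:P).

Lemma horner_binom_poly i k : (binom_poly i).[k%:R] = 'C(k, i)%:R.
Proof.
rewrite /binom_poly hornerZ.
suff -> : (\prod_(m < i) ('X - m%:R%:P)).[k%:R] = (k ^_ i)%:R :> K.
  by rewrite -bin_ffact natrM mulrC mulfK // fact_neq0.
elim: i => [|i ih]; first by rewrite big_ord0 hornerE.
rewrite big_ord_recr hornerM ih ffactnSr natrM !hornerE.
(* Truncated subtraction does no harm: for k < i the factor [k ^_ i] is already 0. *)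
case: (leqP i k) => h; first by rewrite natrB.
by rewrite ffact_small // !mul0r.
Qed.

Lemma size_binom_poly i : (size (binom_poly i) <= i.+1)%N.
Proof.
apply: leq_trans (size_scale_leq _ _) _.
by rewrite size_prod_XsubC /index_enum -enumT size_enum_ord.
Qed.

Lemma coef0_binom_poly i : (binom_poly i)`_0 = (i == 0%N)%:R.
Proof.
rewrite -horner_coef0 -[0]/(0%:R) horner_binom_poly.
by case: i.
Qed.

(* [log_coef 0 = 0] because [0^-1 = 0]. *)
Definition log_coef i : K := (-1) ^+ i.-1 / i%:R.

(** This reflects (1 + t)^X = exp(X log(1 + t)), whose part linear in X is log(1 + t). Concretely,
    the factor X contributes 1 and the others their constant terms -m. *)
Lemma coef1_binom_poly i : (binom_poly i)`_1 = log_coef i.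
Proof.
rewrite /binom_poly /log_coef coefZ; case: i => [|i].
  by rewrite big_ord0 coef1 mulr0 invr0 mulr0.
suff -> : (\prod_(m < i.+1) ('X - m%:R%:P))`_1 = (-1) ^+ i * i`!%:R :> K.
  by rewrite factS natrM invfM mulrCA -mulrA mulVf ?mulr1 ?fact_neq0.
elim: i => [|i ih]; first by rewrite big_ord1 subr0 coefX mulr1.
rewrite big_ord_recr /= mulrBr coefB coefMX coefMC ih /=.
suff -> : (\prod_(m < i.+1) ('X - m%:R%:P))`_0 = 0 :> K.
  by rewrite sub0r exprS factS natrM mulN1r mulNr mulrAC mulrA.
by rewrite -horner_coef0 big_ord_recl hornerM hornerXsubC subrr mul0r.
Qed.

(** The weights [c] extract the linear coefficient of a polynomial from its values; on the product
    C(X, i) C(X, j) this is the Leibniz rule at 0. Degree at most 2N calls for 2N + 1 nodes, and one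
    more keeps their number above 1 when N = 0. *)
Lemma log_coef_functional N : exists c : 'I_(N + N).+2 -> K, forall i j,
  (i <= N)%N -> (j <= N)%N ->
  \sum_k c k * ('C(k, i)%:R * 'C(k, j)%:R) =
  (i == 0%N)%:R * log_coef j + log_coef i * (j == 0%N)%:R.
Proof.
have [//|c hc] := @coef1_from_values (N + N).+2; exists c => i j iN jN.
rewrite -!coef0_binom_poly -!coef1_binom_poly.
transitivity (binom_poly i * binom_poly j)`_1.
  rewrite -hc.
    by apply: eq_bigr => k _; rewrite hornerM !horner_binom_poly.
  apply: leq_trans (size_polyMleq _ _) _.
  apply: (@leq_trans (i.+1 + j.+1).-1).
    by rewrite -!subn1 leq_sub2r // leq_add // size_binom_poly.
  by rewrite addnS /= addSn ltnS leqW // leq_add.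
by rewrite coefM big_ord_recl big_ord1.
Qed.

(** The series log(1 + X) truncated after degree N. *)
Definition log_poly N : {poly K} := \poly_(j < N.+1) log_coef j.

Lemma coef_log_poly_exp N n j : (j < n)%N -> (log_poly N ^+ n)`_j = 0.
Proof.
have /factor_theorem [q hq] : root (log_poly N) 0.
  by rewrite rootE horner_coef0 coef_poly /= /log_coef invr0 mulr0.
by move=> jn; rewrite hq subr0 exprMn coefMXn jn.
Qed.

(* p = sum_m L^m / m! solves (1 + X) p' = p modulo X^N because
   (1 + X) L' = 1 modulo X^N; with p(0) = 1 this determines p modulo X^(N+1). *)
Lemma exp_log_coef N i : (i <= N)%N ->
  (\sum_(m < N.+1) m`!%:R^-1 *: log_poly N ^+ m)`_i =
  ('X + 1 : {poly K})`_i.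
Proof.
set L := log_poly N; set p := \sum_(m < _) _ => iN.
have LX n j : (j < n)%N -> (L ^+ n)`_j = 0 by exact: coef_log_poly_exp.
have hL' j : (j < N)%N -> (('X + 1) * L^`())`_j = (j == 0%N)%:R.
  move=> jN; rewrite mulrDl mul1r coefD coefXM !coef_deriv !coef_poly.
  have hk k : log_coef k.+1 *+ k.+1 = (-1) ^+ k.
    by rewrite -[LHS]mulr_natr /log_coef divfK // natr_neq0.
  case: j jN => [|j] jN /=; first by rewrite add0r !ltnS jN hk.
  by rewrite !ltnS jN (ltnW jN) !hk exprS mulN1r addrN.
(* Differentiating the truncated exponential lowers each index by one, so the top term is lost; it
   lives in degree at least N. *)
have hp' : p^`() = L^`() * (p - N`!%:R^-1 *: L ^+ N).
  rewrite {2}/p big_ord_recr /= addrK /p raddf_sum big_ord_recl /=.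
  rewrite expr0 derivZ derivC scaler0 add0r mulr_sumr; apply: eq_bigr => m _.
  rewrite derivZ deriv_exp -scalerMnr -scaler_nat scalerA -scalerAr; congr (_ *: _).
  by rewrite /bump add1n factS natrM invfM mulrA mulfV ?natr_neq0 // mul1r.
have ode k : (k < N)%N -> (('X + 1) * p^`())`_k = p`_k.
  move=> kN; rewrite hp' mulrA coefM big_ord_recl hL' ?(leq_ltn_trans _ kN) //=.
  rewrite mul1r subn0 big1 => [|m _]; last first.
    by rewrite hL' ?mul0r // /bump add1n (leq_ltn_trans _ kN) // ltn_ord.
  by rewrite addr0 coefB coefZ LX // mulr0 subr0.
have p0 : p`_0 = 1.
  rewrite /p coef_sum big_ord_recl coefZ expr0 coef1 mulr1 invr1 big1 ?addr0 // => m _.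
  by rewrite coefZ LX // mulr0.
have rec k : (k < N)%N -> p`_k.+1 *+ k.+1 = p`_k - p`_k *+ k.
  move=> kN; rewrite -[X in X - _](ode _ kN) mulrDl mul1r coefD coefXM !coef_deriv.
  by case: k {kN} => [|k] /=; rewrite ?mulr0n ?subr0 ?add0r // addrAC subrr add0r.
(* The recurrence gives [p_1 = p_0 = 1], then [2 p_2 = p_1 - p_1 = 0], and zero propagates
   upwards. *)
have p2 k : (k.+2 <= N)%N -> p`_k.+2 = 0.
  have cancel (x : K) m : x *+ m.+1 = 0 -> x = 0.
    by rewrite -mulr_natr => /eqP; rewrite mulf_eq0 (negbTE (natr_neq0 m)) orbF => /eqP.
  elim: k => [|k ih] kN; [apply: (cancel _ 1%N)|apply: (cancel _ k.+2)]; rewrite rec //.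
    by rewrite mulr1n subrr.
  by rewrite ih ?mul0rn ?subr0 // ltnW.
rewrite coefD coefX coef1; case: i iN => [|[|i]] iN; first by rewrite p0 add0r.
- by have := rec _ iN; rewrite mulr1n p0 subr0 addr0.
- by rewrite p2 // add0r.
Qed.
End Coefficients.

(** * Polynomial calculus in J on the filtration of U(g) *)

Section FunctionalCalculus.
Variables (K : fieldType) (g : lieAlgType K).
Local Notation U := (Uenv g).
Local Notation J := (conv_pow (@augm K g)).

Lemma sweedler_sumZ (X : lmodType K) n (c : 'I_n -> K) (b : 'I_n -> U -> U -> X) f :
  \sw_(p, q <- f) (\sum_(i < n) c i *: b i p q) = \sum_(i < n) c i *: sweedler (b i) f.
Proof.
elim: n c b => [|n ih] c b.
  rewrite big_ord0 -[RHS](sweedler0 _ f).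
  by apply: eq_sweedler => p q; rewrite big_ord0.
rewrite big_ord_recl -ih -sweedler_pointwise.
by apply: eq_sweedler => p q; rewrite big_ord_recl.
Qed.

(** The coproduct respects the filtration, so identities known only on one filtration step may be
    used under a Sweedler sum. *)
Lemma eq_sweedler_ufil (X : lmodType K) (b b' : U -> U -> X) k f :
  bilin b -> bilin b' -> ufil k f ->
  (forall u v, ufil k u -> ufil k v -> b u v = b' u v) -> sweedler b f = sweedler b' f.
Proof.
move=> hb hb' hf h; rewrite /sweedler.
elim: (coprod_fil hf) => [i j u v ijk hu hv|s t _ hs _ ht|c s _ hs].
- rewrite (tlift_tens hb) (tlift_tens hb'); apply: h.
    by apply: ufilW hu; rewrite -ijk leq_addr.
  by apply: ufilW hv; rewrite -ijk leq_addl.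
- by rewrite (tliftD hb) (tliftD hb') hs ht.
- by rewrite (tliftZ hb) (tliftZ hb') hs.
Qed.

Lemma eq_conv_pow_ufil (A : algType K) (phi psi : U -> A) k n f :
  linear phi -> linear psi -> (forall u, ufil k u -> phi u = psi u) ->
  ufil k f -> conv_pow phi n f = conv_pow psi n f.
Proof.
move=> hp hq h; elim: n f => [//|n ih] f hf.
apply: (eq_sweedler_ufil (k := k)) => // [||u v hu hv].
- by apply: conv_bilin => //; exact: conv_pow_linear.
- by apply: conv_bilin => //; exact: conv_pow_linear.
- by congr (_ * _); [exact: ih|exact: h].
Qed.

(* The value p(J) of a polynomial at J = id - eta epsilon in the convolution algebra. *)
Implicit Types p q : {poly K}.

Definition calc (p : {poly K}) (f : U) : U := \sum_(i < size p) p`_i *: J i f.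

Lemma calc_wide n p f : (size p <= n)%N -> calc p f = \sum_(i < n) p`_i *: J i f.
Proof.
move=> pn; rewrite /calc (big_ord_widen _ (fun i => p`_i *: J i f) pn) big_mkcond.
apply: eq_bigr => i _; case: ltnP => // h.
by rewrite nth_default // scale0r.
Qed.

(** J^{.i} vanishes on filtration step k once i > k, so only [p] modulo X^(k+1) matters there. *)
Lemma calc_ufil k p f : ufil k f -> calc p f = \sum_(i < k.+1) p`_i *: J i f.
Proof.
move=> hf; rewrite (@calc_wide (k.+1 + size p)) ?leq_addl // big_split_ord /=.
rewrite [X in _ + X]big1 ?addr0 // => i _.
by rewrite (augm_pow_fil hf) ?scaler0 // leq_addr.
Qed.

Lemma J_linear i : linear (J i).
Proof. by apply: conv_pow_linear; exact: augm_linear. Qed.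

Lemma calc_linear p : linear (calc p).
Proof.
move=> c u v; rewrite /calc scaler_sumr -big_split; apply: eq_bigr => i _ /=.
by rewrite J_linear scalerDr !scalerA mulrC.
Qed.

Lemma calcP c p q f : calc (c *: p + q) f = c *: calc p f + calc q f.
Proof.
pose n := maxn (size p) (size q).
have hp : (size p <= n)%N by exact: leq_maxl.
have hq : (size q <= n)%N by exact: leq_maxr.
rewrite (calc_wide _ hp) (calc_wide _ hq) (@calc_wide n); last first.
  apply: leq_trans (size_polyD _ _) _; rewrite geq_max hq andbT.
  exact: leq_trans (size_scale_leq _ _) hp.
rewrite scaler_sumr -big_split; apply: eq_bigr => i _ /=.
by rewrite coefD coefZ scalerDl scalerA.
Qed.

Lemma calcC c f : calc c%:P f = c *: conv_unit U f.
Proof. by rewrite (@calc_wide 1) ?size_polyC_leq1 // big_ord1 coefC. Qed.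

Lemma calcMX p : calc (p * 'X) =1 conv (calc p) (@augm K g).
Proof.
move=> f; rewrite (@calc_wide (size p).+1); last first.
  apply: leq_trans (size_polyMleq _ _) _; by rewrite size_polyX addn2.
rewrite big_ord_recl coefMX scale0r add0r.
transitivity (\sum_(i < size p) p`_i *: J i.+1 f).
  by apply: eq_bigr => i _; rewrite coefMX.
rewrite -(sweedler_sumZ _ (fun i u v => J i u * augm v)); apply: eq_sweedler => u v.
by rewrite mulr_suml; apply: eq_bigr => i _; rewrite scalerAl.
Qed.

(** Horner induction on [q] reduces multiplicativity to multiplication by X, which is [calcMX], and
    associativity of convolution. *)
Lemma calcM p q : calc (p * q) =1 conv (calc p) (calc q).
Proof.
have hl := calc_linear; have hJ := @augm_linear K g.
elim/poly_ind: q => [|q c ih] f.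
  rewrite mulr0 /conv -[RHS](eq_sweedler (b := fun _ _ => 0)).
    by rewrite sweedler0 /calc size_poly0 big_ord0.
  by move=> u v; rewrite /calc size_poly0 big_ord0 mulr0.
have -> : p * (q * 'X + c%:P) = c *: p + p * q * 'X.
  by rewrite mulrDr mulrA [p * c%:P]mulrC mul_polyC addrC.
have E v : calc (q * 'X + c%:P) v = c *: conv_unit U v + conv (calc q) (@augm K g) v.
  by rewrite -[q * 'X]scale1r calcP calcMX calcC scale1r addrC.
rewrite [RHS](eq_conv (frefl _) E) calcP calcMX (eq_conv ih (frefl _)) convA //.
rewrite -{1}(conv_unitr (hl p)) /conv -sweedler_pointwise.
by apply: eq_sweedler => u v; rewrite mulrDr scalerAr.
Qed.

Lemma calc_pow p n : calc (p ^+ n) =1 conv_pow (calc p) n.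
Proof.
elim: n => [|n ih] f; first by rewrite expr0 calcC scale1r.
by rewrite exprSr calcM; apply: eq_conv.
Qed.

Lemma calc_id f : calc ('X + 1) f = f.
Proof.
rewrite -['X]mul1r -[1 * 'X]scale1r calcP calcMX calcC !scale1r.
rewrite (eq_conv (phi' := conv_unit U) (psi' := @augm K g)) //; last first.
  by move=> u; rewrite calcC scale1r.
rewrite conv_unitl; last exact: augm_linear.
by rewrite /augm subrK.
Qed.

(** Binomial expansion of Psi^k = (1 + J)^k, cut off at the filtration degree. The number of terms
    does not depend on k, which makes Psi^k(f) polynomial in k. *)
Lemma conv_pow_id_ufil n k f : ufil n f ->
  conv_pow id k f = \sum_(i < n.+1) 'C(k, i)%:R *: J i f.
Proof.
move=> hf; transitivity (conv_pow (calc ('X + 1)) k f).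
  apply: (eq_conv_pow_ufil (k := n)) => // [|u _]; first exact: calc_linear.
  by rewrite calc_id.
rewrite -calc_pow (calc_ufil _ hf); apply: eq_bigr => i _; congr (_ *: _).
elim: k (nat_of_ord i) => [|k ih] [|m]; rewrite ?expr0 ?coef1 //.
  by rewrite exprSr mulrDr mulr1 coefD coefMX add0r ih !bin0.
by rewrite exprSr mulrDr mulr1 coefD coefMX !ih binS natrD addrC.
Qed.
End FunctionalCalculus.

(** Vanishing beyond N makes the support finite, so the default value 0 of the finitely supported
    sum does not interfere. *)
Lemma fsum_pos (V : nmodType) (F : nat -> V) N : (forall n, (N < n)%N -> F n = 0) ->
  F 0%N + \sum_(n \in [set n | (0 < n)%N]) F n = \sum_(i < N.+1) F i.
Proof.
move=> hF; rewrite -(big_mkord xpredT F) big_ltn //; congr (_ + _).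
rewrite (fsbigE (index_iota 1 N.+1)) ?iota_uniq //.
- rewrite big_seq_cond [RHS]big_seq_cond; apply: eq_bigl => i.
  rewrite andbT; case: (boolP (i \in index_iota _ _)) => //=.
  by rewrite mem_index_iota => /andP[i0 _]; apply/mem_set.
- by move=> i /=; rewrite mem_index_iota => /andP[].
- move=> i /= i0; rewrite mem_index_iota i0 /= -leqNgt; exact: hF.
Qed.

(** * Bilinear expansion of pure tensors *)

Lemma tens_sumZ (K : fieldType) (V W : lmodType K) m n (x : 'I_m -> K) (p : 'I_m -> V)
    (y : 'I_n -> K) (q : 'I_n -> W) :
  (\sum_i x i *: p i) \ox (\sum_j y j *: q j) =
  \sum_i \sum_j (x i * y j) *: (p i \ox q j).
Proof.
rewrite (linear_fun_sumZ (h := fun v => v \ox _)) => [|c u v]; last exact: tens_linl.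
apply: eq_bigr => i _; rewrite (linear_fun_sumZ (h := tens (p i))) => [|c u v].
  by rewrite scaler_sumr; apply: eq_bigr => j _; rewrite scalerA.
exact: tens_linr.
Qed.

Lemma tens_scalel (K : fieldType) (V W : lmodType K) c (v : V) (w : W) :
  (c *: v) \ox w = c *: (v \ox w).
Proof. by apply: (linear_funZ (h := fun x => x \ox w)) => ? ? ?; exact: tens_linl. Qed.

Lemma tens_scaler (K : fieldType) (V W : lmodType K) c (v : V) (w : W) :
  v \ox (c *: w) = c *: (v \ox w).
Proof. by apply: (linear_funZ (h := tens v)) => ? ? ?; exact: tens_linr. Qed.

Lemma tens_comp_bilin (K : fieldType) (V W V' W' : lmodType K)
    (phi : V -> V') (psi : W -> W') :
  linear phi -> linear psi -> bilin (fun v w => phi v \ox psi w).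
Proof. by move=> hp hq; split=> *; rewrite (hp, hq) (tens_linl, tens_linr). Qed.

(** * Solomon elements: linearity, exponential sum and primitivity *)

Section Solomon.
Variables (K : fieldType) (g : lieAlgType K).
Local Notation U := (Uenv g).
Local Notation J := (conv_pow (@augm K g)).
Implicit Types f u v : U.

Lemma sweedler_tens f : sweedler (@tens K U U) f = coprod f.
Proof.
have hb := tens_bilin U U; rewrite /sweedler.
elim/tens_ind: (coprod f) => [p q|s t hs ht|c s hs].
- by rewrite (tlift_tens hb).
- by rewrite (tliftD hb) hs ht.
- by rewrite (tliftZ hb) hs.
Qed.

Lemma conv_pow_id_linear k : linear (conv_pow (A := U) id k).
Proof. by apply: conv_pow_linear. Qed.

(* The convolution powers of the identity are coalgebra maps because the
   coproduct is multiplicative and cocommutative. *)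
Lemma coprod_conv_pow_id k f : coprod (conv_pow id k f) =
  \sw_(p, q <- f) (conv_pow id k p \ox conv_pow id k q).
Proof.
have hl := conv_pow_id_linear.
elim: k f => [|k ih] f.
  rewrite /conv_pow /= /conv_unit linearZ /= rmorph1.
  rewrite -(sweedler_counitl f (h := fun q => counit q *: (1 : tensor U U))).
    by apply: eq_sweedler => p q; rewrite tens_scalel tens_scaler.
  by move=> c u v; rewrite linearP scalerDl scalerA.
rewrite /conv_pow iterS -/(conv_pow _ k) /conv.
rewrite (sweedler_linear_map _ _ (@coprod_linear K g)).
(* Multiplicativity of the coproduct and the induction hypothesis give this fourfold sum; the target
   differs from it by swapping q and r. *)
transitivity (\sw_(a, b <- f) \sw_(p, q <- a) \sw_(r, s <- b)
    ((conv_pow id k p * r) \ox (conv_pow id k q * s))).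
  apply: eq_sweedler => a b; rewrite rmorphM /= ih.
  rewrite (sweedler_linear_map (F := fun x : tensor U U => x * coprod b)); last first.
    by move=> c s t; rewrite mulrDl -tens_scaleAl.
  apply: eq_sweedler => p q; rewrite -sweedler_tens.
  rewrite (sweedler_linear_map (F := fun x : tensor U U => _ * x)); last first.
    by move=> c s t; rewrite mulrDr -tens_scaleAr.
  by apply: eq_sweedler => r s; rewrite tensM.
rewrite sweedler_exchange.
- apply: eq_sweedler => a b.
  rewrite [RHS](sweedler_linear_map (F := fun v => v \ox _)); last first.
    by move=> c u v; exact: tens_linl.
  apply: eq_sweedler => p q; rewrite [RHS](sweedler_linear_map (F := tens _)) //.
  by move=> c u v; exact: tens_linr.
- by move=> *; move=> c u v; rewrite hl mulr_linearl tens_linl.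
- by move=> *; move=> c u v; rewrite hl mulr_linearl tens_linr.
- by move=> *; move=> c u v; rewrite mulr_linearr tens_linl.
- by move=> *; move=> c u v; rewrite mulr_linearr tens_linr.
Qed.

Lemma sol1_calc N f : ufil N f -> sol1 f = calc (log_poly K N) f.
Proof.
move=> hf; rewrite (calc_ufil _ hf).
transitivity (\sum_(i < N.+1) log_coef K i *: J i f).
  (* The index 0, absent from [sol1], enters with coefficient [log_coef 0 = 0]. *)
  rewrite -(fsum_pos (F := fun i => log_coef K i *: J i f)).
    by rewrite {1}/log_coef invr0 mulr0 scale0r add0r.
  by move=> n hn; rewrite (augm_pow_fil hf hn) scaler0.
by apply: eq_bigr => i _; rewrite coef_poly ltn_ord.
Qed.

(** The polynomial representing [sol1] depends on the filtration degree, so both vectors are first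
    put into a common step. *)
Lemma sol1_linear : linear (@sol1 K g).
Proof.
move=> c u v; have [i hu] := ufil_ex u; have [j hv] := ufil_ex v.
have {}hu : ufil (i + j) u by apply: ufilW hu; rewrite leq_addr.
have {}hv : ufil (i + j) v by apply: ufilW hv; rewrite leq_addl.
rewrite (sol1_calc hu) (sol1_calc hv) -calc_linear; apply: sol1_calc.
by apply: ufil_add => //; exact: ufil_scale.
Qed.

Lemma sol_linear n : linear (@sol K g n).
Proof.
move=> c u v; rewrite /sol (conv_pow_linear n sol1_linear) scalerDr !scalerA.
by rewrite mulrC.
Qed.

Lemma sol_calc N n f : ufil N f -> sol n f = n`!%:R^-1 *: calc (log_poly K N ^+ n) f.
Proof.
move=> hf; rewrite /sol calc_pow; congr (_ *: _).
apply: (eq_conv_pow_ufil (k := N)) => // [||u hu].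
- exact: sol1_linear.
- exact: calc_linear.
- exact: sol1_calc.
Qed.

(** The n-th power of the logarithm is divisible by X^n, and J^{.i} kills step N for i > N. *)
Lemma sol_eq0 N n f : ufil N f -> (N < n)%N -> sol n f = 0.
Proof.
move=> hf Nn; rewrite (sol_calc _ hf) (calc_ufil _ hf) big1 ?scaler0 // => i _.
by rewrite coef_log_poly_exp ?scale0r // (leq_ltn_trans _ Nn) // -ltnS ltn_ord.
Qed.

Hypothesis charK0 : [pchar K] =i pred0.

(** This is id = exp(log id): the polynomials agree with 1 + X up to degree N, which suffices on
    step N. *)
Lemma sum_sol N f : ufil N f -> \sum_(n < N.+1) sol n f = f.
Proof.
move=> hf; under eq_bigr => n _ do rewrite (sol_calc _ hf).
rewrite -(linear_fun_sumZ (h := fun p => calc p f)); last by move=> c p q; exact: calcP.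
rewrite -[RHS]calc_id !(calc_ufil _ hf); apply: eq_bigr => i _.
by rewrite exp_log_coef // -ltnS.
Qed.

Lemma sol1_primitive f : coprod (sol1 f) = sol1 f \ox 1 + 1 \ox sol1 f.
Proof.
have [N hf] := ufil_ex f; have [c hc] := log_coef_functional charK0 N.
have hs := sol1_linear; have hu := @conv_unit_linear K g U.
have solE u : ufil N u -> sol1 u = \sum_(i < N.+1) log_coef K i *: J i u.
  move=> h; rewrite (sol1_calc h) (calc_ufil _ h).
  by apply: eq_bigr => i _; rewrite coef_poly ltn_ord.
have unitE u : ufil N u ->
    conv_unit U u = \sum_(i < N.+1) (i == 0%N :> nat)%:R *: J i u.
  move=> h; rewrite -[LHS]scale1r -calcC (calc_ufil _ h).
  by apply: eq_bigr => i _; rewrite coef1.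
(* Taking j = 0 in the functional leaves [log_coef i], so [sol1] is the combination of the Psi^k
   with weights [c]. *)
have psiE u : ufil N u -> sol1 u = \sum_k c k *: conv_pow id k u.
  move=> h; rewrite (solE _ h).
  under [RHS]eq_bigr => k _ do rewrite (conv_pow_id_ufil _ h) scaler_sumr.
  rewrite exchange_big; apply: eq_bigr => i _.
  under [RHS]eq_bigr => k _ do rewrite scalerA.
  rewrite -scaler_suml; congr (_ *: _); have := hc i 0%N (ltn_ord i) (leq0n N).
  rewrite {1}/log_coef invr0 !mulr0 add0r mulr1 => <-.
  by apply: eq_bigr => k _; rewrite bin0 mulr1.
rewrite {1}(psiE _ hf) (linear_fun_sumZ (@coprod_linear K g)).
under eq_bigr => k _ do rewrite coprod_conv_pow_id.
rewrite -sweedler_sumZ.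
have bilinD (b b' : U -> U -> tensor U U) :
    bilin b -> bilin b' -> bilin (fun p q => b p q + b' p q).
  move=> hb hb'; split=> *; first by rewrite hb.1 hb'.1 scalerDr addrACA.
  by rewrite hb.2 hb'.2 scalerDr addrACA.
have bilinZ n (d : 'I_n -> K) (b : 'I_n -> U -> U -> tensor U U) :
    (forall i, bilin (b i)) -> bilin (fun p q => \sum_(i < n) d i *: b i p q).
  move=> hb; split=> *; rewrite scaler_sumr -big_split; apply: eq_bigr => i _ /=.
    by rewrite (hb i).1 scalerDr !scalerA mulrC.
  by rewrite (hb i).2 scalerDr !scalerA mulrC.
transitivity (\sw_(p, q <- f) (sol1 p \ox conv_unit U q + conv_unit U p \ox sol1 q)).
  apply: (eq_sweedler_ufil (k := N)) => // [||u v ku kv].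
  - by apply: bilinZ => k; apply: tens_comp_bilin; exact: conv_pow_id_linear.
  - by apply: bilinD; exact: tens_comp_bilin.
  (* Both sides are expanded in the tensors [J i u \ox J j v]; their coefficients match by the
     Leibniz identity [hc]. *)
  - rewrite (solE _ ku) (solE _ kv) (unitE _ ku) (unitE _ kv) !tens_sumZ -big_split /=.
    transitivity (\sum_k \sum_(i < N.+1) \sum_(j < N.+1)
        (c k * ('C(k, i)%:R * 'C(k, j)%:R)) *: (J i u \ox J j v)).
      apply: eq_bigr => k _; rewrite !(conv_pow_id_ufil _ ku) !(conv_pow_id_ufil _ kv).
      rewrite tens_sumZ scaler_sumr; apply: eq_bigr => i _.
      by rewrite scaler_sumr; apply: eq_bigr => j _; rewrite scalerA.
    rewrite exchange_big; apply: eq_bigr => i _; rewrite exchange_big -big_split.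
    apply: eq_bigr => j _; rewrite -[RHS]scalerDl -scaler_suml.
    by rewrite (hc i j (ltn_ord i) (ltn_ord j)) [X in X *: _]addrC.
(* The counit axiom collapses each of the two sums. *)
rewrite sweedlerD; congr (_ + _).
- rewrite -(sweedler_counitr f (h := fun p => sol1 p \ox 1)).
    by apply: eq_sweedler => p q; rewrite tens_scaler.
  by move=> d u v; rewrite hs tens_linl.
- rewrite -(sweedler_counitl f (h := fun q => 1 \ox sol1 q)).
    by apply: eq_sweedler => p q; rewrite tens_scalel.
  by move=> d u v; rewrite hs tens_linr.
Qed.
End Solomon.

(** * The action of U(a): equivariance of Solomon elements, and the sharp product *)

Section Equivariance.
Variables (K : fieldType) (g a : lieAlgType K) (M : rightLieModule g a).
Local Notation Ug := (Uenv g).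
Local Notation Ua := (Uenv a).
Implicit Types (f : Ug) (A : Ua).

(** The derivation is also a coderivation, because it sends generators to generators and these are
    primitive. *)
Lemma sweedler_uder (X : lmodType K) (b : Ug -> Ug -> X) u f : bilin b ->
  sweedler b (uder M u f) =
  \sw_(p, q <- f) (b (uder M u p) q + b p (uder M u q)).
Proof.
move=> hb; have hD := @uder_linear _ _ _ M u.
have hB (b' : Ug -> Ug -> X) : bilin b' ->
    bilin (fun p q => b' (uder M u p) q + b' p (uder M u q)).
  by move=> hb'; split=> *; rewrite hD !(hb'.1, hb'.2) scalerDr addrACA.
elim/Uenv_gen_ind: f b hb => [|c v w hv hw|x v hv] b hb.
- by rewrite uder1 (sweedler1 (hB _ hb)) uder1 (bilin0l hb) (bilin0r hb) addr0
    (linear_fun0 (sweedler_linear hb)).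
- by rewrite hD (sweedler_linear hb) (sweedler_linear (hB _ hb)) hv ?hw.
- have hx := mulr_linearr (ugen x).
  have hl : bilin (fun p q => b (ugen x * p) q) by split=> *; rewrite ?hx (hb.1, hb.2).
  have hr : bilin (fun p q => b p (ugen x * q)) by split=> *; rewrite ?hx (hb.1, hb.2).
  rewrite uderM uder_gen (linear_funD (sweedler_linear hb)).
  rewrite (sweedler_gen _ _ hb) (sweedler_gen _ _ hb) (sweedler_gen _ _ (hB _ hb)).
  rewrite (hv _ hl) (hv _ hr) -!sweedlerD; apply: eq_sweedler => p q.
  rewrite !uderM !uder_gen.
  have hbl z : linear (b^~ z) by move=> c r t; rewrite hb.1.
  have hbr z : linear (b z) by move=> c r t; rewrite hb.2.
  rewrite (linear_funD (hbl _)) (linear_funD (hbr _)) -!addrA; congr (_ + _).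
  by rewrite addrCA; congr (_ + _); rewrite addrCA; congr (_ + _); rewrite addrCA.
Qed.

Lemma counit_uder u f : counit (uder M u f) = 0.
Proof.
elim/Uenv_gen_ind: f => [|c v w hv hw|x v hv].
- by rewrite uder1 linear0.
- by rewrite !linearP /= hv hw mulr0 addr0.
- by rewrite uderM uder_gen linearD !rmorphM /= hv !counit_gen !mul0r addr0.
Qed.

(** A map that is both derivation and coderivation commutes with convolution products of maps
    commuting with it. *)
Lemma conv_pow_uder (phi : Ug -> Ug) u n f : linear phi ->
  (forall f, phi (uder M u f) = uder M u (phi f)) ->
  conv_pow phi n (uder M u f) = uder M u (conv_pow phi n f).
Proof.
move=> hl h; have hD := @uder_linear _ _ _ M u.
elim: n f => [|n ih] f.
  by rewrite /conv_pow /= /conv_unit counit_uder scale0r linearZ /= uder1 scaler0.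
rewrite /conv_pow !iterS -/(conv_pow phi n) /conv sweedler_uder; last first.
  by apply: conv_bilin => //; exact: conv_pow_linear.
rewrite (sweedler_linear_map _ _ hD); apply: eq_sweedler => p q.
by rewrite uderM ih h.
Qed.

Lemma sol1_uder u f : sol1 (uder M u f) = uder M u (sol1 f).
Proof.
have [i hf] := ufil_ex f; have [j hDf] := ufil_ex (uder M u f).
have {}hf : ufil (i + j) f by apply: ufilW hf; rewrite leq_addr.
have {}hDf : ufil (i + j) (uder M u f) by apply: ufilW hDf; rewrite leq_addl.
rewrite (sol1_calc hf) (sol1_calc hDf) /calc linear_sum; apply: eq_bigr => k _.
rewrite linearZ conv_pow_uder //; first exact: augm_linear.
move=> v; rewrite /augm /conv_unit counit_uder scale0r linearB /=.
  by rewrite [in RHS](linear_funZ (@uder_linear _ _ _ M u)) uder1 scaler0.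
Qed.

(** U(a) is generated by a, whose elements act by derivations commuting with [sol1] and hence with
    its convolution powers. *)
Lemma sol_uact n f A : sol n (uact M f A) = uact M (sol n f) A.
Proof.
elim/Uenv_ind: A f => [|u|A B hA hB|c A hA|A B hA hB] f.
- by rewrite !uact1.
- rewrite !uact_gen /sol linearZ conv_pow_uder //; first exact: sol1_linear.
  exact: sol1_uder.
- have hl := uact_linearr M; have hs := @sol_linear _ g n.
  by rewrite !(linear_funD (hl _)) (linear_funD hs) hA hB.
- have hl := uact_linearr M; have hs := @sol_linear _ g n.
  by rewrite !(linear_funZ (hl _)) (linear_funZ hs) hA.
- by rewrite !uactM hB hA.
Qed.

Lemma uact_one A : uact M 1 A = (counit A)%:A.
Proof.
have hl := uact_linearr M.
elim/Uenv_ind: A => [|u|A B hA hB|c A hA|A B hA hB].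
- by rewrite uact1 rmorph1 scale1r.
- by rewrite uact_gen uder1 counit_gen scale0r.
- by rewrite (linear_funD (hl _)) hA hB linearD scalerDl.
- by rewrite (linear_funZ (hl _)) hA scalerA linearZ.
- by rewrite uactM hA (linear_funZ (uact_linearl _ _)) hB rmorphM /= scalerA.
Qed.

(** Of the two terms of the coproduct of psi(q), [1 \ox psi q] yields the convolution and
    [psi q \ox 1] yields the action, with the sign of the antipode. *)
Lemma sharp_primitive (phi psi : Ug -> Ua) f : linear phi ->
  (forall f, coprod (psi f) = psi f \ox 1 + 1 \ox psi f) ->
  sharp M phi psi f = conv phi psi f - phi (\sw_(p, q <- f) uact M p (psi q)).
Proof.
move=> hl hp; have hr := uact_linearr M.
rewrite (sweedler_linear_map _ _ hl) [RHS]addrC -scaleN1r -sweedler_pointwise.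
apply: eq_sweedler => p q; rewrite sweedler_primitive // => [|].
  rewrite antipode_primitive // antipode1 uact1 mulr1.
  by rewrite (linear_funN (hr _)) (linear_funN hl) scaleN1r.
split=> [w c v v'|v c w w']; last by rewrite mulrDr -scalerAr.
by rewrite linearP hr hl mulrDl -scalerAl.
Qed.

(** * Hopf O-operators on primitives and the recursion for T after [sol n] *)

Section Operator.
Variable T : {linear Ug -> Ua}.
Hypothesis hT : is_hopf_O_operator M T.

(** [T 1] is grouplike, and the operator identity at e = f = 1 makes it idempotent because U(a) acts
    on 1 through its counit. *)
Lemma hopfO1 : T 1 = 1.
Proof.
apply: grouplike_idempotent.
- rewrite (hopfO_coprod hT) sweedler1 //.
  by apply: tens_comp_bilin; exact: linearP.
- by rewrite (hopfO_counit hT) rmorph1.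
- rewrite (hopfO_mul hT) sweedler1.
    by rewrite uact_one (hopfO_counit hT) rmorph1 scale1r mulr1.
  split=> [w c v v'|v c w w']; last by rewrite mulrDr -scalerAr.
  by rewrite linearP uact_linearr mulrDl -scalerAl.
Qed.

Lemma hopfO_primitive (p : Ug) : coprod p = p \ox 1 + 1 \ox p ->
  coprod (T p) = T p \ox 1 + 1 \ox T p.
Proof.
move=> hp; rewrite (hopfO_coprod hT) sweedler_primitive // ?hopfO1 //.
by apply: tens_comp_bilin; exact: linearP.
Qed.

(** For primitive [p] the argument of T in the operator identity is [uact M e (T p) + e * p], using
    [T 1 = 1]. *)
Lemma hopfO_mulr_primitive (e p : Ug) : coprod p = p \ox 1 + 1 \ox p ->
  T (e * p) = T e * T p - T (uact M e (T p)).
Proof.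
move=> hp; rewrite (hopfO_mul hT) sweedler_primitive //.
  by rewrite hopfO1 uact1 mulr1 linearD addrAC subrr add0r.
split=> [w c v v'|v c w w']; last by rewrite mulrDr -scalerAr.
by rewrite linearP uact_linearr mulrDl -scalerAl.
Qed.

Hypothesis charK0 : [pchar K] =i pred0.

Lemma hopfO_sol_rec n f : n.+1%:R *: T (sol n.+1 f) =
  conv (T \o sol n) (T \o @sol1 K g) f
    - T (sol n (\sw_(p, q <- f) uact M p (T (sol1 q)))).
Proof.
have hs := @sol_linear _ g n.
(* The factor n + 1 turns 1/(n+1)! into 1/n!, the normalisation of [sol n]. *)
have -> : n.+1%:R *: T (sol n.+1 f) = T (conv (sol n) (@sol1 K g) f).
  rewrite -linearZ /sol scalerA factS natrM invfM mulrA mulfV ?natr_neq0 // mul1r.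
  congr (T _); rewrite /conv_pow iterS -/(conv_pow _ n) /conv.
  rewrite (sweedler_linear_map (F := *:%R _)).
    by apply: eq_sweedler => p q; rewrite scalerAl.
  by move=> c u v; rewrite scalerDr !scalerA mulrC.
rewrite (sweedler_linear_map _ _ (linearP T)).
have hTs : linear (T \o sol n) by move=> c u v /=; rewrite hs linearP.
rewrite -[T (sol n _)]/((T \o sol n) _) (sweedler_linear_map _ _ hTs).
rewrite [RHS]addrC -scaleN1r -sweedler_pointwise; apply: eq_sweedler => p q.
by rewrite hopfO_mulr_primitive ?sol1_primitive //= sol_uact scaleN1r addrC.
Qed.

Lemma hopfO_sol_recE n f : n.+1%:R *: T (sol n.+1 f) =
  sharp M (T \o sol n) (T \o @sol1 K g) f.
Proof.
rewrite hopfO_sol_rec sharp_primitive //.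
  by move=> c u v /=; rewrite sol_linear linearP.
by move=> v; apply: hopfO_primitive; exact: sol1_primitive.
Qed.

(** The induction starts at n = 0, where [T 1 = 1] identifies T after [sol 0] with the unit of the
    sharp product. *)
Lemma sharp_pow_hopfO n f : sharp_pow M (T \o @sol1 K g) n f = n`!%:R *: T (sol n f).
Proof.
elim: n f => [|n ih] f.
  by rewrite /sol invr1 !scale1r linearZ /= hopfO1.
rewrite factS mulnC natrM -scalerA hopfO_sol_recE /sharp_pow iterS -/(sharp_pow M _ n).
have hZ c : linear ( *:%R c : Ua -> Ua).
  by move=> d u v; rewrite scalerDr !scalerA mulrC.
rewrite /sharp (sweedler_linear_map _ _ (hZ _)); apply: eq_sweedler => p q.
rewrite (sweedler_linear_map _ _ (hZ _)); apply: eq_sweedler => r s.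
by rewrite ih scalerAl.
Qed.
End Operator.
End Equivariance.

(** * The recursion for Gamma_n and the exponential formula *)

Theorem theorem4p2p3 (K : fieldType) (charK0 : [pchar K] =i pred0)
    (g a : lieAlgType K) (M : rightLieModule g a)
    (T : {linear Uenv g -> Uenv a}) (hT : is_hopf_O_operator M T) :
  let Gamma := fun n : nat => T \o sol n in
  (forall n : nat, (1 <= n)%N -> forall f : Uenv g,
     n.+1%:R *: Gamma n.+1 f
       = conv (Gamma n) (Gamma 1%N) f
         - Gamma n (\sw_(f1, f2 <- f) uact M f1 (Gamma 1%N f2))
     /\ conv (Gamma n) (Gamma 1%N) f
         - Gamma n (\sw_(f1, f2 <- f) uact M f1 (Gamma 1%N f2))
       = n`!%:R^-1 *: sharp_pow M (Gamma 1%N) n.+1 f)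
  /\ (forall f : Uenv g,
        (exists N, forall n, (N <= n)%N -> sharp_pow M (T \o sol1 (g:=g)) n f = 0)
        /\ T f = exp_sharp M (T \o sol1 (g:=g)) f).
Proof.
move=> Gamma.
have G1 : Gamma 1%N = T \o @sol1 K g.
  apply/funext => f; rewrite /Gamma /= /sol invr1 scale1r.
  congr (T _); apply: conv_unitl; exact: sol1_linear.
have rec n f : n.+1%:R *: Gamma n.+1 f = conv (Gamma n) (Gamma 1%N) f
    - Gamma n (\sw_(f1, f2 <- f) uact M f1 (Gamma 1%N f2)).
  by rewrite G1; exact: hopfO_sol_rec.
split=> [n _ f|f].
  split; first exact: rec.
  rewrite -rec G1 sharp_pow_hopfO // scalerA factS mulnC natrM mulrA mulVf ?mul1r //.
  exact: fact_neq0.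
have [N hf] := ufil_ex f.
(* The sharp powers inherit vanishing from [sol n], so the exponential series at [f] is a finite
   sum. *)
have h0 n : (N < n)%N -> sharp_pow M (T \o @sol1 K g) n f = 0.
  by move=> Nn; rewrite sharp_pow_hopfO // (sol_eq0 hf Nn) linear0 scaler0.
split; first by exists N.+1.
(* The separate unit term of [exp_sharp] is the summand at n = 0. *)
have := @fsum_pos _ (fun n => n`!%:R^-1 *: sharp_pow M (T \o @sol1 K g) n f) N.
rewrite invr1 scale1r /exp_sharp => -> => [|n /h0 ->]; last by rewrite scaler0.
rewrite -{1}(sum_sol charK0 hf) linear_sum; apply: eq_bigr => n _.
by rewrite sharp_pow_hopfO // scalerA mulVf ?scale1r // fact_neq0.
Qed.
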